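(* Let $\mathcal{C}$ be a localizing subcategory of an abelian category $\mathcal{A}$. Then for all $\mathcal{C}$-saturated objects $M,N\in\mathcal{A}$ the map $$\widehat{\mathscr{Q}}^{\mathrm{Ext}}:\ \varinjlim_{M'\le M,\ M/M'\in\mathcal{C}}\mathrm{Ext}^1_{\mathcal{A}}(M',N)\ \longrightarrow\ \mathrm{Ext}^1_{\mathrm{Sat}_{\mathcal{C}}(\mathcal{A})}(\widehat{\mathscr{Q}}(M),\widehat{\mathscr{Q}}(N))\ \cong\ \mathrm{Ext}^1_{\mathcal{A}/\mathcal{C}}(\mathscr{Q}(M),\mathscr{Q}(N))$$ is an isomorphism of abelian groups.
   Context: A non-empty full subcategory $\mathcal{C}$ of an abelian category $\mathcal{A}$ is thick if it is closed under passing to subobjects, factor objects and extensions. The Serre quotient $\mathcal{A}/\mathcal{C}$ has the same objects as $\mathcal{A}$ and $\mathrm{Hom}_{\mathcal{A}/\mathcal{C}}(M,N)=\varinjlim \mathrm{Hom}_{\mathcal{A}}(M',N/N')$ over subobjects $M'\le M$, $N'\le N$ with $M/M',N'\in\mathcal{C}$; the canonical functor $\mathscr{Q}:\mathcal{A}\to\mathcal{A}/\mathcal{C}$ is the identity on objects, sends a morphism to its class, and is exact. A thick subcategory $\mathcal{C}$ is localizing if $\mathscr{Q}$ admits a right adjoint $\mathscr{S}:\mathcal{A}/\mathcal{C}\to\mathcal{A}$. An object $M\in\mathcal{A}$ is $\mathcal{C}$-torsion-free if it has no nonzero subobjects in $\mathcal{C}$. It is $\mathcal{C}$-saturated if it is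 $\mathcal{C}$-torsion-free and every short exact sequence $0\to M\to E\to C\to 0$ with $C\in\mathcal{C}$ splits (for localizing $\mathcal{C}$, equivalently, the unit $M\to(\mathscr{S}\circ\mathscr{Q})(M)$ is an isomorphism). $\mathrm{Sat}_{\mathcal{C}}(\mathcal{A})\subset\mathcal{A}$ is the full subcategory of $\mathcal{C}$-saturated objects; for localizing $\mathcal{C}$ it is equivalent to $\mathcal{A}/\mathcal{C}$ via the restriction of $\mathscr{Q}$ and the corestriction of $\mathscr{S}$, hence is an abelian category (in general not an abelian subcategory of $\mathcal{A}$). The functor $\widehat{\mathscr{Q}}:\mathcal{A}\to\mathrm{Sat}_{\mathcal{C}}(\mathcal{A})$ is the corestriction of $\mathscr{S}\circ\mathscr{Q}$; it is exact and left adjoint to the inclusion. $\mathrm{Ext}^1$ is Yoneda's Ext: classes of short exact sequences $0\leftarrow M\leftarrow G_1\leftarrow N\leftarrow 0$ (in the indicated abelian category) modulo the equivalence relation generated by chain morphisms that are the identity on $M$ and $N$. The direct limit is over all subobjects $M'\le M$ with $M/M'\in\mathcal{C}$, ordered by reverse inclusion, with transition maps given by pullback along inclusions $M''\hookrightarrow M'$. The map $\widehat{\mathscr{Q}}^{\mathrm{Ext}}$ is induced by applying the exact functor $\widehat{\mathscr{Q}}$ to representing sequences, $\mathrm{Ext}^1_{\mathcal{A}}(M',N)\to\mathrm{Ext}^1_{\mathrm{Sat}_{\mathcal{C}}(\mathcal{A})}(\widehat{\mathscr{Q}}(M'),\widehat{\mathscr{Q}}(N))$, followed by the identification with $\mathrm{Ext}^1_{\mathrm{Sat}_{\mathcal{C}}(\mathcal{A})}(\widehat{\mathscr{Q}}(M),\widehat{\mathscr{Q}}(N))$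 via the isomorphism $\widehat{\mathscr{Q}}(M'\hookrightarrow M)$. The last isomorphism in the claim is the one induced by the equivalence $\mathrm{Sat}_{\mathcal{C}}(\mathcal{A})\simeq\mathcal{A}/\mathcal{C}$. *)

(* Defs.v *)
From HB Require Import structures.
From Stdlib Require Import Relations.
From mathcomp Require Import all_boot ssralg.
From mathcomp Require Import boolp.

Set Implicit Arguments.
Unset Strict Implicit.
Unset Printing Implicit Defensive.

Import GRing.Theory.
Local Open Scope ring_scope.

Section GeneratedQuotient.
Variables (T : Type) (R : T -> T -> Prop).

(* [clos_refl_sym_trans] makes [quot R] the quotient by the equivalence
   relation generated by R *)
Definition gen_rel (x y : {classic T}) : bool :=
  `[< clos_refl_sym_trans T R x y >].

Lemma gen_rel_equiv : equiv_class_of gen_rel.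
Proof.
split=> [x|x y|y x z].
- by apply/asboolP; apply: rst_refl.
- by apply/asboolP/asboolP => h; apply: rst_sym.
- by move=> /asboolP h1 /asboolP h2; apply/asboolP; apply: rst_trans h1 h2.
Qed.

Canonical gen_equiv := EquivRelPack gen_rel_equiv.

Definition quot : Type := {eq_quot gen_equiv}%qT.
Definition class (x : T) : quot := (\pi_({eq_quot gen_equiv}) (x : {classic T}))%qT.

HB.instance Definition _ := Choice.on quot.

Lemma class_surj (q : quot) : exists x, q = class x.
Proof. by exists (repr q); rewrite /class reprK. Qed.

Lemma class_gen x y : class x = class y <-> clos_refl_sym_trans T R x y.
Proof.
split=> [/eqmodP h|h]; first exact/asboolP.
by apply/eqmodP/asboolP.
Qed.

Hypothesis Rrefl : forall x, R x x.
Hypothesis Rsym : forall x y, R x y -> R y x.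
Hypothesis Rtrans : forall x y z, R x y -> R y z -> R x z.

Lemma class_eq x y : class x = class y <-> R x y.
Proof.
split=> [/class_gen|h]; last by apply/class_gen; apply: rst_step.
by elim=> //; [move=> ? ? _; apply: Rsym | move=> ? ? ? _ h1 _ h2; apply: Rtrans h1 h2].
Qed.

End GeneratedQuotient.

Arguments class {T} R x.

(* The group structure on morphisms is part of the data; being abelian is then
   the property [abelian] below. *)
Record preadditive := Preadditive {
  ob :> Type;
  hom : ob -> ob -> zmodType;
  idm : forall X, hom X X;
  comp : forall X Y Z, hom Y Z -> hom X Y -> hom X Z;
  compA : forall W X Y Z (h : hom Y Z) (g : hom X Y) (f : hom W X),
    comp h (comp g f) = comp (comp h g) f;
  comp1m : forall X Y (f : hom X Y), comp (idm Y) f = f;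
  compm1 : forall X Y (f : hom X Y), comp f (idm X) = f;
  compDm : forall X Y Z (g g' : hom Y Z) (f : hom X Y),
    comp (g + g') f = comp g f + comp g' f;
  compmD : forall X Y Z (g : hom Y Z) (f f' : hom X Y),
    comp g (f + f') = comp g f + comp g f'
}.

Arguments hom {_} X Y.
Arguments idm {_} X.
Arguments comp {_ X Y Z} g f.
Notation "g ∘ f" := (comp g f) (at level 40, left associativity).

Definition op (A : preadditive) : preadditive :=
  @Preadditive (ob A) (fun X Y => @hom A Y X) (@idm A)
    (fun X Y Z g f => f ∘ g)
    (fun W X Y Z h g f => esym (compA f g h))
    (fun X Y f => compm1 f) (fun X Y f => comp1m f)
    (fun X Y Z g g' f => compmD f g g') (fun X Y Z g f f' => compDm f f' g).

Section Preadditive.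
Variable A : preadditive.
Implicit Types X Y Z W : A.

Lemma comp0m X Y Z (f : hom X Y) : (0 : hom Y Z) ∘ f = 0.
Proof. by apply: (addrI (0 ∘ f)); rewrite -compDm !addr0. Qed.
Lemma compm0 X Y Z (f : hom Y Z) : f ∘ (0 : hom X Y) = 0.
Proof. by apply: (addrI (f ∘ 0)); rewrite -compmD !addr0. Qed.
Lemma compNm X Y Z (g : hom Y Z) (f : hom X Y) : (- g) ∘ f = - (g ∘ f).
Proof. by apply/eqP; rewrite -addr_eq0 -compDm addNr comp0m. Qed.
Lemma compmN X Y Z (g : hom Y Z) (f : hom X Y) : g ∘ (- f) = - (g ∘ f).
Proof. by apply/eqP; rewrite -addr_eq0 -compmD addNr compm0. Qed.
Lemma compBm X Y Z (g g' : hom Y Z) (f : hom X Y) :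
  (g - g') ∘ f = g ∘ f - g' ∘ f.
Proof. by rewrite compDm compNm. Qed.
Lemma compmB X Y Z (g : hom Y Z) (f f' : hom X Y) :
  g ∘ (f - f') = g ∘ f - g ∘ f'.
Proof. by rewrite compmD compmN. Qed.

Definition mono X Y (f : hom X Y) : Prop :=
  forall W (g h : hom W X), f ∘ g = f ∘ h -> g = h.

Definition epi X Y (f : hom X Y) : Prop :=
  forall W (g h : hom Y W), g ∘ f = h ∘ f -> g = h.

Definition iso X Y (f : hom X Y) : Prop :=
  exists g : hom Y X, g ∘ f = idm X /\ f ∘ g = idm Y.

(* morphisms always exist, so uniqueness says initial, resp. terminal *)
Definition zero_ob Z : Prop :=
  (forall X (f g : hom Z X), f = g) /\ (forall X (f g : hom X Z), f = g).

Definition is_kernel K X Y (k : hom K X) (f : hom X Y) : Prop :=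
  f ∘ k = 0 /\
  forall W (g : hom W X), f ∘ g = 0 -> exists! h : hom W K, k ∘ h = g.

Definition is_cokernel X Y Q (c : hom Y Q) (f : hom X Y) : Prop :=
  c ∘ f = 0 /\
  forall W (g : hom Y W), g ∘ f = 0 -> exists! h : hom Q W, h ∘ c = g.

Definition is_biproduct X1 X2 P (i1 : hom X1 P) (i2 : hom X2 P)
    (p1 : hom P X1) (p2 : hom P X2) : Prop :=
  [/\ p1 ∘ i1 = idm X1, p2 ∘ i2 = idm X2, p1 ∘ i2 = 0, p2 ∘ i1 = 0
    & i1 ∘ p1 + i2 ∘ p2 = idm P].

(* 0 -> N -> G -> M -> 0; both conditions are internal to the category, so
   that in a full subcategory they differ from those of the ambient category *)
Definition short_exact N G M (i : hom N G) (p : hom G M) : Prop :=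
  is_kernel i p /\ is_cokernel p i.

End Preadditive.

Record abelian (A : preadditive) : Prop := Abelian {
  ab_zero : exists Z : A, zero_ob Z;
  ab_biproduct : forall X1 X2 : A, exists P (i1 : hom X1 P) (i2 : hom X2 P) p1 p2,
    is_biproduct i1 i2 p1 p2;
  ab_kernel : forall (X Y : A) (f : hom X Y), exists K (k : hom K X), is_kernel k f;
  ab_cokernel : forall (X Y : A) (f : hom X Y), exists Q (c : hom Y Q), is_cokernel c f;
  ab_mono : forall (X Y : A) (f : hom X Y), mono f ->
    exists Z (g : hom Y Z), is_kernel f g;
  ab_epi : forall (X Y : A) (f : hom X Y), epi f ->
    exists W (g : hom W X), is_cokernel f g
}.

Record abelianCat := AbelianCat {
  abelianCat_cat :> preadditive;
  abelianCatP : abelian abelianCat_cat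
}.

Lemma op_abelian (A : preadditive) : abelian A -> abelian (op A).
Proof.
case=> [[Z [h1 h2]] bip ker coker mon ep]; split.
- by exists Z; split.
- move=> X1 X2; have [P [i1 [i2 [p1 [p2 [a b c d e]]]]]] := bip X1 X2.
  by exists P, p1, p2, i1, i2; split.
- by move=> X Y f; apply: coker.
- by move=> X Y f; apply: ker.
- by move=> X Y f; apply: ep.
- by move=> X Y f; apply: mon.
Qed.

Definition opA (A : abelianCat) : abelianCat := AbelianCat (op_abelian (abelianCatP A)).

Section PreadditiveTheory.
Variable A : preadditive.
Implicit Types X Y Z W : A.

Lemma zero_obE Z : zero_ob Z <-> idm Z = 0.
Proof.
split=> [[h _]|h]; first exact: h.
split=> X f g.
- by rewrite -(compm1 f) -(compm1 g) h !compm0.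
- by rewrite -(comp1m f) -(comp1m g) h !comp0m.
Qed.

Lemma mono0 X Y (f : hom X Y) :
  mono f <-> forall W (g : hom W X), f ∘ g = 0 -> g = 0.
Proof.
split=> [h W g e|h W g g' e]; first by apply: h; rewrite e compm0.
by apply/eqP; rewrite -subr_eq0; apply/eqP/h; rewrite compmB e subrr.
Qed.

Lemma mono_comp X Y Z (g : hom Y Z) (f : hom X Y) : mono g -> mono f -> mono (g ∘ f).
Proof. by move=> hg hf W u v; rewrite -!compA => /hg/hf. Qed.

Lemma mono_compr X Y Z (g : hom Y Z) (f : hom X Y) : mono (g ∘ f) -> mono f.
Proof. by move=> h W u v e; apply: h; rewrite -!compA e. Qed.

Lemma mono_id X : mono (idm X).
Proof. by move=> W g h; rewrite !comp1m. Qed.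

Lemma iso_id X : iso (idm X).
Proof. by exists (idm X); rewrite !comp1m. Qed.

Lemma iso_comp X Y Z (g : hom Y Z) (f : hom X Y) : iso g -> iso f -> iso (g ∘ f).
Proof.
move=> [g' [a b]] [f' [c d]]; exists (f' ∘ g'); split.
- by rewrite compA -(compA f') a compm1 c.
- by rewrite compA -(compA g) d compm1 b.
Qed.

Lemma iso_mono X Y (f : hom X Y) : iso f -> mono f.
Proof. by move=> [f' [a b]] W g h e; rewrite -(comp1m g) -(comp1m h) -a -!compA e. Qed.

Lemma kernel_mono K X Y (k : hom K X) (f : hom X Y) : is_kernel k f -> mono k.
Proof.
move=> [e h] W u v euv.
have [|w [_ hw]] := h _ (k ∘ u); first by rewrite compA e comp0m.
by rewrite -(hw u) // -(hw v).
Qed.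

Lemma kernel_lift K X Y (k : hom K X) (f : hom X Y) W (g : hom W X) :
  is_kernel k f -> f ∘ g = 0 -> exists h : hom W K, k ∘ h = g.
Proof. by move=> [_ h] /h[w [e _]]; exists w. Qed.

Lemma is_kernelI K X Y (k : hom K X) (f : hom X Y) :
  f ∘ k = 0 -> mono k ->
  (forall W (g : hom W X), f ∘ g = 0 -> exists h : hom W K, k ∘ h = g) ->
  is_kernel k f.
Proof.
move=> e m h; split=> // W g /h[w ew]; exists w; split=> // w' ew'.
by apply: m; rewrite ew.
Qed.

Lemma kernel_iso K K' X Y (k : hom K X) (k' : hom K' X) (f : hom X Y) :
  is_kernel k f -> is_kernel k' f -> exists2 u : hom K K', iso u & k = k' ∘ u.
Proof.
move=> hk hk'; have [u hu] := kernel_lift hk' (proj1 hk).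
have [v hv] := kernel_lift hk (proj1 hk').
exists u => //; exists v; split.
- by apply: (kernel_mono hk); rewrite compA hv hu compm1.
- by apply: (kernel_mono hk'); rewrite compA hu hv compm1.
Qed.

Lemma kernel_isor K K' X Y (k : hom K X) (u : hom K' K) (f : hom X Y) :
  is_kernel k f -> iso u -> is_kernel (k ∘ u) f.
Proof.
move=> hk hu; apply: is_kernelI.
- by rewrite compA (proj1 hk) comp0m.
- exact: mono_comp (kernel_mono hk) (iso_mono hu).
- move=> W g /(kernel_lift hk)[h <-]; have [v [_ e]] := hu.
  by exists (v ∘ h); rewrite -compA (compA u) e comp1m.
Qed.

Lemma kernel_monol K X Y Z (k : hom K X) (f : hom X Y) (m : hom Y Z) :
  mono m -> is_kernel k (m ∘ f) <-> is_kernel k f.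
Proof.
move=> hm; split=> [[e h]|[e h]]; split.
- by apply: hm; rewrite compA e compm0.
- by move=> W g eg; apply: h; rewrite -compA eg compm0.
- by rewrite -compA e compm0.
- by move=> W g; rewrite -compA => eg; apply: h; apply: hm; rewrite eg compm0.
Qed.

End PreadditiveTheory.

Section PreadditiveDual.
Variable A : preadditive.
Implicit Types X Y Z W : A.

Lemma epi0 X Y (f : hom X Y) :
  epi f <-> forall W (g : hom Y W), g ∘ f = 0 -> g = 0.
Proof. exact: (@mono0 (op A)). Qed.
Lemma epi_comp X Y Z (g : hom Y Z) (f : hom X Y) : epi g -> epi f -> epi (g ∘ f).
Proof. by move=> hg hf; apply: (@mono_comp (op A)). Qed.
Lemma epi_compl X Y Z (g : hom Y Z) (f : hom X Y) : epi (g ∘ f) -> epi g.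
Proof. exact: (@mono_compr (op A)). Qed.
Lemma epi_id X : epi (idm X). Proof. exact: (@mono_id (op A)). Qed.
Lemma iso_op X Y (f : hom X Y) : iso f -> @iso (op A) Y X f.
Proof. by move=> [g [a b]]; exists g. Qed.
Lemma op_iso X Y (f : hom X Y) : @iso (op A) Y X f -> iso f.
Proof. by move=> [g [a b]]; exists g. Qed.
Lemma iso_epi X Y (f : hom X Y) : iso f -> epi f.
Proof. by move=> h; apply: (@iso_mono (op A)); apply: iso_op. Qed.
Lemma cokernel_epi X Y Q (c : hom Y Q) (f : hom X Y) : is_cokernel c f -> epi c.
Proof. exact: (@kernel_mono (op A)). Qed.
Lemma cokernel_desc X Y Q (c : hom Y Q) (f : hom X Y) W (g : hom Y W) :
  is_cokernel c f -> g ∘ f = 0 -> exists h : hom Q W, h ∘ c = g.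
Proof. exact: (@kernel_lift (op A)). Qed.
Lemma is_cokernelI X Y Q (c : hom Y Q) (f : hom X Y) :
  c ∘ f = 0 -> epi c ->
  (forall W (g : hom Y W), g ∘ f = 0 -> exists h : hom Q W, h ∘ c = g) ->
  is_cokernel c f.
Proof. exact: (@is_kernelI (op A)). Qed.
Lemma cokernel_isol X Y Q Q' (c : hom Y Q) (u : hom Q Q') (f : hom X Y) :
  is_cokernel c f -> iso u -> is_cokernel (u ∘ c) f.
Proof. by move=> hc /iso_op; apply: (@kernel_isor (op A)). Qed.
Lemma cokernel_epir X Y Q Z (c : hom Y Q) (f : hom X Y) (e : hom Z X) :
  epi e -> is_cokernel c (f ∘ e) <-> is_cokernel c f.
Proof. exact: (@kernel_monol (op A)). Qed.
Lemma op_zero Z : zero_ob Z -> @zero_ob (op A) Z.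
Proof. by case. Qed.

End PreadditiveDual.

Section AbelianTheory.
Variable A : abelianCat.
Implicit Types X Y Z W : A.
Let abA := abelianCatP A.

Definition ker_ob X Y (f : hom X Y) : A := projT1 (cid (ab_kernel abA f)).
Definition ker X Y (f : hom X Y) : hom (ker_ob f) X :=
  projT1 (cid (projT2 (cid (ab_kernel abA f)))).
Lemma kerP X Y (f : hom X Y) : is_kernel (ker f) f.
Proof. exact: (projT2 (cid (projT2 (cid (ab_kernel abA f))))). Qed.

Definition coker_ob X Y (f : hom X Y) : A := projT1 (cid (ab_cokernel abA f)).
Definition coker X Y (f : hom X Y) : hom Y (coker_ob f) :=
  projT1 (cid (projT2 (cid (ab_cokernel abA f)))).
Lemma cokerP X Y (f : hom X Y) : is_cokernel (coker f) f.
Proof. exact: (projT2 (cid (projT2 (cid (ab_cokernel abA f))))). Qed.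

Lemma ker_mono X Y (f : hom X Y) : mono (ker f).
Proof. exact: kernel_mono (kerP f). Qed.
Lemma coker_epi X Y (f : hom X Y) : epi (coker f).
Proof. exact: cokernel_epi (cokerP f). Qed.
Lemma ker0 X Y (f : hom X Y) : f ∘ ker f = 0. Proof. exact: (proj1 (kerP f)). Qed.
Lemma coker0 X Y (f : hom X Y) : coker f ∘ f = 0.
Proof. exact: (proj1 (cokerP f)). Qed.

Lemma mono_kernel X Y Q (m : hom X Y) (c : hom Y Q) :
  mono m -> is_cokernel c m -> is_kernel m c.
Proof.
move=> hm hc; have [Z [g hg]] := ab_mono abA hm.
apply: is_kernelI => //; first exact: proj1 hc.
have [g' eg'] := cokernel_desc hc (proj1 hg).
by move=> W u eu; apply: (kernel_lift hg); rewrite -eg' -compA eu compm0.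
Qed.

Lemma image X Y (f : hom X Y) :
  exists I (m : hom I Y) (e : hom X I), [/\ mono m, epi e & f = m ∘ e].
Proof.
have hm := kerP (coker f); have [e ee] := kernel_lift hm (coker0 f).
exists (ker_ob (coker f)), (ker (coker f)), e; split=> //; first exact: ker_mono.
apply/epi0 => W g ge0; set m := ker (coker f).
have [e' ee'] := kernel_lift (kerP g) ge0.
have mk : mono (m ∘ ker g) by apply: mono_comp; apply: ker_mono.
have hk := mono_kernel mk (cokerP _).
have [d ed] : exists d, d ∘ coker f = coker (m ∘ ker g).
  apply: (cokernel_desc (cokerP f)).
  have h : (m ∘ ker g) ∘ e' = f by rewrite -compA ee' ee.
  transitivity (coker (m ∘ ker g) ∘ ((m ∘ ker g) ∘ e')); first by rewrite h.
  by rewrite compA coker0 comp0m.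
have [w ew] : exists w, (m ∘ ker g) ∘ w = m.
  by apply: (kernel_lift hk); rewrite -ed -compA ker0 compm0.
have kw : ker g ∘ w = idm _.
  by apply: (@ker_mono _ _ (coker f)); rewrite compA; apply: etrans ew _; rewrite compm1.
by rewrite -(compm1 g) -kw compA ker0 comp0m.
Qed.

Lemma mono_epi_iso X Y (f : hom X Y) : mono f -> epi f -> iso f.
Proof.
move=> hm he; have hk := mono_kernel hm (cokerP f).
have c0 : coker f = 0 by apply: (proj1 (epi0 f) he); apply: coker0.
have [g eg] : exists g, f ∘ g = idm Y by apply: (kernel_lift hk); rewrite c0 comp0m.
by exists g; split=> //; apply: hm; rewrite compA eg comp1m compm1.
Qed.

Lemma zeroP : { Z : A | zero_ob Z }.
Proof. exact: cid (ab_zero abA). Qed.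

Lemma epi_coker0 X Y (f : hom X Y) : zero_ob (coker_ob f) -> epi f.
Proof.
move=> [h _]; apply/epi0 => W g /(cokernel_desc (cokerP f))[u <-].
by rewrite (h _ u 0) comp0m.
Qed.

End AbelianTheory.

Section AbelianDual.
Variable A : abelianCat.
Implicit Types X Y Z W : A.

Lemma epi_cokernel X Y K (e : hom X Y) (k : hom K X) :
  epi e -> is_kernel k e -> is_cokernel e k.
Proof. exact: (@mono_kernel (opA A)). Qed.

Lemma mono_ses X Y Q (m : hom X Y) (c : hom Y Q) :
  mono m -> is_cokernel c m -> short_exact m c.
Proof. by move=> hm hc; split=> //; apply: mono_kernel. Qed.
Lemma epi_ses X Y K (e : hom X Y) (k : hom K X) :
  epi e -> is_kernel k e -> short_exact k e.
Proof. by move=> hm hc; split=> //; apply: epi_cokernel. Qed.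

Lemma mono_ker0 X Y (f : hom X Y) : zero_ob (ker_ob f) -> mono f.
Proof.
move=> [_ h]; apply/mono0 => W g /(kernel_lift (kerP f))[u <-].
by rewrite (h _ u 0) compm0.
Qed.

Definition is_pullback X Y Z P (f : hom X Z) (g : hom Y Z) (p : hom P X) (q : hom P Y) :=
  f ∘ p = g ∘ q /\
  forall W (u : hom W X) (v : hom W Y), f ∘ u = g ∘ v ->
    exists! w : hom W P, p ∘ w = u /\ q ∘ w = v.

Lemma biproduct_eq X1 X2 P (i1 : hom X1 P) (i2 : hom X2 P) p1 p2 W (u v : hom W P) :
  is_biproduct i1 i2 p1 p2 -> p1 ∘ u = p1 ∘ v -> p2 ∘ u = p2 ∘ v -> u = v.
Proof.
move=> [_ _ _ _ e] e1 e2.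
by rewrite -(comp1m u) -(comp1m v) -e !compDm -!compA e1 e2.
Qed.

Lemma pullback_ex X Y Z (f : hom X Z) (g : hom Y Z) :
  exists P (p : hom P X) (q : hom P Y), is_pullback f g p q.
Proof.
have [B [i1 [i2 [p1 [p2 hB]]]]] := ab_biproduct (abelianCatP A) X Y.
set d := f ∘ p1 - g ∘ p2.
exists (ker_ob d), (p1 ∘ ker d), (p2 ∘ ker d); split.
  by apply/eqP; rewrite -subr_eq0 !compA -compBm ker0.
have [e11 e22 e12 e21 e] := hB.
move=> W u v euv; have h : d ∘ (i1 ∘ u + i2 ∘ v) = 0.
  rewrite compmD !compA !compBm -!compA (compA p1 i1) (compA p2 i1) (compA p1 i2).
  by rewrite (compA p2 i2) e11 e22 e12 e21 !comp1m !comp0m !compm0 euv subr0 add0r subrr.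
have [w ew] := kernel_lift (kerP d) h; exists w; split.
  rewrite -!compA ew !compmD !compA e11 e22 e12 e21.
  by rewrite !comp1m !comp0m addr0 add0r.
move=> w' [h1 h2]; apply: (@ker_mono _ _ _ d).
apply: (biproduct_eq hB); rewrite ew.
- by rewrite compmD !compA e11 e12 comp1m comp0m addr0.
- by rewrite compmD !compA e22 e21 comp1m comp0m add0r.
Qed.

Lemma pullback_lift X Y Z P (f : hom X Z) (g : hom Y Z) (p : hom P X) (q : hom P Y) W
    (u : hom W X) (v : hom W Y) : is_pullback f g p q -> f ∘ u = g ∘ v ->
  exists w : hom W P, p ∘ w = u /\ q ∘ w = v.
Proof. by move=> [_ h] /h[w [? _]]; exists w. Qed.

Lemma pullback_eq X Y Z P (f : hom X Z) (g : hom Y Z) (p : hom P X) (q : hom P Y) W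
    (u v : hom W P) : is_pullback f g p q -> p ∘ u = p ∘ v -> q ∘ u = q ∘ v -> u = v.
Proof.
move=> [e h] e1 e2; have [|w [_ hw]] := h _ (p ∘ u) (q ∘ u).
  by rewrite !compA e.
by rewrite -(hw u) // -(hw v).
Qed.

Lemma pullback_sym X Y Z P (f : hom X Z) (g : hom Y Z) (p : hom P X) (q : hom P Y) :
  is_pullback f g p q -> is_pullback g f q p.
Proof.
move=> [e h]; split=> // W u v /esym/h[w [[a b] c]].
by exists w; split=> // w' [a' b']; apply: c.
Qed.

Lemma pullback_iso X Y Z P P' (f : hom X Z) (g : hom Y Z) (p : hom P X) (q : hom P Y)
    (p' : hom P' X) (q' : hom P' Y) :
  is_pullback f g p q -> is_pullback f g p' q' ->
  exists2 u : hom P P', iso u & p = p' ∘ u /\ q = q' ∘ u.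
Proof.
move=> h h'; have [u [u1 u2]] := pullback_lift h' (proj1 h).
have [v [v1 v2]] := pullback_lift h (proj1 h').
exists u => //; exists v; split.
- by apply: (pullback_eq h); rewrite compA ?v1 ?v2 ?u1 ?u2 compm1.
- by apply: (pullback_eq h'); rewrite compA ?u1 ?u2 ?v1 ?v2 compm1.
Qed.

Lemma pullback_mono X Y Z P (f : hom X Z) (g : hom Y Z) (p : hom P X) (q : hom P Y) :
  is_pullback f g p q -> mono f -> mono q.
Proof.
move=> h hf W u v e; apply: (pullback_eq h) => //.
by apply: hf; rewrite !compA (proj1 h) -!compA e.
Qed.

Lemma pullback_kernel X Y Z P K (f : hom X Z) (g : hom Y Z) (p : hom P X) (q : hom P Y)
    (k : hom K X) : is_pullback f g p q -> is_kernel k f ->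
  exists2 k' : hom K P, is_kernel k' q & p ∘ k' = k.
Proof.
move=> h hk; have [|k' [e1 e2]] := pullback_lift (u := k) (v := 0) h.
  by rewrite (proj1 hk) compm0.
exists k' => //; apply: is_kernelI => //.
  by apply: (mono_compr (g := p)); rewrite e1; apply: kernel_mono hk.
move=> W u eu; have [|w ew] := kernel_lift (g := p ∘ u) hk.
  by rewrite compA (proj1 h) -compA eu compm0.
exists w; apply: (pullback_eq h); first by rewrite compA e1 ew.
by rewrite compA e2 eu comp0m.
Qed.

Lemma pullback_epi X Y Z P (f : hom X Z) (g : hom Y Z) (p : hom P X) (q : hom P Y) :
  is_pullback f g p q -> epi f -> epi q.
Proof.
move=> hP hf.
have [B [i1 [i2 [p1 [p2 hB]]]]] := ab_biproduct (abelianCatP A) X Y.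
have [e11 e22 e12 e21 e] := hB.
set d := f ∘ p1 - g ∘ p2; set k := i1 ∘ p + i2 ∘ q.
have pk1 : p1 ∘ k = p by rewrite compmD !compA e11 e12 comp1m comp0m addr0.
have pk2 : p2 ∘ k = q by rewrite compmD !compA e22 e21 comp1m comp0m add0r.
have di1 : d ∘ i1 = f by rewrite compBm -!compA e11 e21 compm1 compm0 subr0.
have hk : is_kernel k d.
  apply: is_kernelI.
  - by rewrite compBm -!compA pk1 pk2 (proj1 hP) subrr.
  - move=> W u v euv; apply: (pullback_eq hP).
    + by rewrite -pk1 -!compA euv.
    + by rewrite -pk2 -!compA euv.
  - move=> W u eu; have [|w [e1 e2]] := pullback_lift (u := p1 ∘ u) (v := p2 ∘ u) hP.
      by apply/eqP; rewrite -subr_eq0 !compA -compBm eu.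
    exists w; apply: (biproduct_eq hB).
    + by rewrite compA pk1.
    + by rewrite compA pk2.
have hd : epi d by apply: (epi_compl (f := i1)); rewrite di1.
have hc := epi_cokernel hd hk.
apply/epi0 => W h hq0.
have [w ew] : exists w, w ∘ d = h ∘ p2.
  by apply: (cokernel_desc hc); rewrite -compA pk2.
have w0 : w = 0.
  apply: (proj1 (epi0 f) hf).
  by rewrite -di1 compA ew -compA e21 compm0.
by rewrite -(compm1 h) -e22 compA -ew w0 !comp0m.
Qed.

Definition is_pushout X Y Z P (f : hom Z X) (g : hom Z Y) (p : hom X P) (q : hom Y P) :=
  p ∘ f = q ∘ g /\
  forall W (u : hom X W) (v : hom Y W), u ∘ f = v ∘ g ->
    exists! w : hom P W, w ∘ p = u /\ w ∘ q = v.

End AbelianDual.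

Section AbelianDual2.
Variable A : abelianCat.
Implicit Types X Y Z W : A.

Lemma pushout_ex X Y Z (f : hom Z X) (g : hom Z Y) :
  exists P (p : hom X P) (q : hom Y P), is_pushout f g p q.
Proof. exact: (@pullback_ex (opA A)). Qed.
Lemma pushout_desc X Y Z P (f : hom Z X) (g : hom Z Y) (p : hom X P) (q : hom Y P) W
    (u : hom X W) (v : hom Y W) : is_pushout f g p q -> u ∘ f = v ∘ g ->
  exists w : hom P W, w ∘ p = u /\ w ∘ q = v.
Proof. exact: (@pullback_lift (opA A)). Qed.
Lemma pushout_mono X Y Z P (f : hom Z X) (g : hom Z Y) (p : hom X P) (q : hom Y P) :
  is_pushout f g p q -> mono f -> mono q.
Proof. exact: (@pullback_epi (opA A)). Qed.
Lemma pushout_epi X Y Z P (f : hom Z X) (g : hom Z Y) (p : hom X P) (q : hom Y P) :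
  is_pushout f g p q -> epi f -> epi q.
Proof. exact: (@pullback_mono (opA A)). Qed.
Lemma pushout_cokernel X Y Z P Q (f : hom Z X) (g : hom Z Y) (p : hom X P) (q : hom Y P)
    (c : hom X Q) : is_pushout f g p q -> is_cokernel c f ->
  exists2 c' : hom P Q, is_cokernel c' q & c' ∘ p = c.
Proof. exact: (@pullback_kernel (opA A)). Qed.

End AbelianDual2.

Section QuotLift.
Variables (T S : Type) (R : T -> T -> Prop) (f : T -> S).

Definition quot_lift (q : quot R) : S := f (projT1 (cid (class_surj q))).

Hypothesis fR : forall x y, R x y -> f x = f y.

Lemma quot_liftE x : quot_lift (class R x) = f x.
Proof.
rewrite /quot_lift; case: (cid _) => y /= /class_gen.
by elim=> // [u v /fR|u v w _ -> _ ->].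
Qed.

End QuotLift.

Record directSystem := DirectSystem {
  ds_index : Type;
  ds_le : ds_index -> ds_index -> Prop;
  ds_refl : forall i, ds_le i i;
  ds_trans : forall i j k, ds_le i j -> ds_le j k -> ds_le i k;
  ds_directed : forall i j, exists k, ds_le i k /\ ds_le j k;
  ds_inhabited : exists i : ds_index, True;
  ds_obj : ds_index -> zmodType;
  ds_map : forall i j, ds_le i j -> {additive ds_obj i -> ds_obj j};
  ds_map_id : forall i (h : ds_le i i) x, ds_map h x = x;
  ds_map_comp : forall i j k (h : ds_le i j) (h' : ds_le j k) (h'' : ds_le i k) x,
    ds_map h' (ds_map h x) = ds_map h'' x
}.

Section DirectLimit.
Variable D : directSystem.
Let I := ds_index D.
Implicit Types i j k : I.

Definition dl_rel (x y : {i : I & ds_obj i}) : Prop :=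
  exists k (h : ds_le (projT1 x) k) (h' : ds_le (projT1 y) k),
    ds_map h (projT2 x) = ds_map h' (projT2 y).

Definition dirlim : Type := quot dl_rel.
HB.instance Definition _ := Choice.copy dirlim (quot dl_rel).

Definition dl_in i (x : ds_obj i) : dirlim := class dl_rel (existT _ i x).

Lemma dl_surj (a : dirlim) : exists i (x : ds_obj i), a = dl_in x.
Proof. by have [[i x] ->] := class_surj a; exists i, x. Qed.

Lemma dl_eq i j (x : ds_obj i) (y : ds_obj j) :
  dl_in x = dl_in y <->
  exists k (h : ds_le i k) (h' : ds_le j k), ds_map h x = ds_map h' y.
Proof.
apply: class_eq => {i j x y}.
- by move=> [i x]; exists i, (ds_refl i), (ds_refl i).
- by move=> [i x] [j y] [k [h [h' e]]]; exists k, h', h.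
- move=> [i x] [j y] [k z] [l [/= h1 [h2 e]]] [m [/= h3 [h4 e']]].
  have [n [hl hm]] := ds_directed l m.
  exists n, (ds_trans h1 hl), (ds_trans h4 hm) => /=.
  rewrite -(ds_map_comp h1 hl) e -(ds_map_comp h4 hm) -e'.
  by rewrite (ds_map_comp _ _ (ds_trans h2 hl)) (ds_map_comp _ _ (ds_trans h2 hl)).
Qed.

Lemma dl_in_map i j (h : ds_le i j) (x : ds_obj i) : dl_in (ds_map h x) = dl_in x.
Proof.
apply/dl_eq; exists j, (ds_refl j), h.
by rewrite (ds_map_comp _ _ h).
Qed.

Lemma dl_surj2 (a b : dirlim) : exists i (x y : ds_obj i), a = dl_in x /\ b = dl_in y.
Proof.
have [i [x ->]] := dl_surj a; have [j [y ->]] := dl_surj b.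
have [k [h h']] := ds_directed i j.
by exists k, (ds_map h x), (ds_map h' y); rewrite !dl_in_map.
Qed.

Lemma dl_add_ex (a b : dirlim) : exists c : dirlim,
  exists i (x y : ds_obj i), [/\ a = dl_in x, b = dl_in y & c = dl_in (x + y)].
Proof. by have [i [x [y [-> ->]]]] := dl_surj2 a b; exists (dl_in (x + y)), i, x, y. Qed.

Definition dl_add (a b : dirlim) : dirlim := projT1 (cid (dl_add_ex a b)).

Lemma dl_addE i (x y : ds_obj i) : dl_add (dl_in x) (dl_in y) = dl_in (x + y).
Proof.
rewrite /dl_add; case: (cid _) => c /= [j [x' [y' [ex ey ->]]]].
have [k [h1 [h2 e1]]] := proj1 (dl_eq _ _) ex.
have [l [h3 [h4 e2]]] := proj1 (dl_eq _ _) ey.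
have [m [hk hl]] := ds_directed k l.
have a := ds_trans h2 hk; have b := ds_trans h1 hk.
apply/dl_eq; exists m, a, b; rewrite !raddfD /=; congr (_ + _).
- by rewrite -(ds_map_comp h2 hk) -(ds_map_comp h1 hk) e1.
- by rewrite -(ds_map_comp h4 hl) -(ds_map_comp h3 hl) e2.
Qed.

Definition dl_opp (a : dirlim) : dirlim :=
  quot_lift (fun x => dl_in (- projT2 x)) a.

Lemma dl_oppE i (x : ds_obj i) : dl_opp (dl_in x) = dl_in (- x).
Proof.
apply: (quot_liftE (f := fun x => dl_in (- projT2 x))) => -[j y] [k z] [l [h [h' /= e]]].
by apply/dl_eq; exists l, h, h'; rewrite !raddfN e.
Qed.

Definition dl_zero : dirlim := dl_in (0 : ds_obj (projT1 (cid (ds_inhabited D)))).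

Lemma dl_zeroE i : dl_in (0 : ds_obj i) = dl_zero.
Proof.
have [k [h h']] := ds_directed i (projT1 (cid (ds_inhabited D))).
by apply/dl_eq; exists k, h, h'; rewrite !raddf0.
Qed.

Lemma dl_addA : associative dl_add.
Proof.
move=> a b c; have [i [x [y [-> ->]]]] := dl_surj2 a b; have [j [z ->]] := dl_surj c.
have [k [h h']] := ds_directed i j.
rewrite -(dl_in_map h x) -(dl_in_map h y) -(dl_in_map h' z).
by rewrite !dl_addE addrA.
Qed.

Lemma dl_addC : commutative dl_add.
Proof.
by move=> a b; have [i [x [y [-> ->]]]] := dl_surj2 a b; rewrite !dl_addE addrC.
Qed.

Lemma dl_add0 : left_id dl_zero dl_add.
Proof. by move=> a; have [i [x ->]] := dl_surj a; rewrite -(dl_zeroE i) dl_addE add0r. Qed.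

Lemma dl_addN : left_inverse dl_zero dl_opp dl_add.
Proof.
by move=> a; have [i [x ->]] := dl_surj a; rewrite dl_oppE dl_addE addNr dl_zeroE.
Qed.

HB.instance Definition _ := GRing.isZmodule.Build dirlim dl_addA dl_addC dl_add0 dl_addN.

Lemma dl_inD i (x y : ds_obj i) : dl_in (x + y) = dl_in x + dl_in y.
Proof. by rewrite -dl_addE. Qed.

Lemma dl_in0 i : dl_in (0 : ds_obj i) = 0.
Proof. exact: dl_zeroE. Qed.

Section Cocone.
Variables (V : zmodType) (f : forall i, {additive ds_obj i -> V}).
Hypothesis fP : forall i j (h : ds_le i j) x, f j (ds_map h x) = f i x.

Definition dl_desc (_ : forall i j (h : ds_le i j) x, f j (ds_map h x) = f i x)
  (a : dirlim) : V := quot_lift (fun x => f (projT1 x) (projT2 x)) a.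

Lemma dl_descE i (x : ds_obj i) : dl_desc fP (dl_in x) = f i x.
Proof.
apply: (quot_liftE (f := fun x => f (projT1 x) (projT2 x))) => -[j y] [k z] [l [h [h' /= e]]].
by rewrite -(fP h) -(fP h') e.
Qed.

Lemma dl_desc_additive : zmod_morphism (dl_desc fP).
Proof.
move=> a b; have [i [x [y [-> ->]]]] := dl_surj2 a b.
have -> : dl_in x - dl_in y = dl_in (x - y).
  by rewrite dl_inD; congr (_ + _); apply/eqP; rewrite eq_sym -addr_eq0 -dl_inD addNr dl_in0.
by rewrite !dl_descE raddfB.
Qed.

HB.instance Definition _ := GRing.isZmodMorphism.Build dirlim V (dl_desc fP) dl_desc_additive.

End Cocone.
End DirectLimit.

(* not assumed additive *)
Record functor (A B : preadditive) := Functor {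
  fob :> A -> B;
  fmor : forall X Y : A, hom X Y -> hom (fob X) (fob Y);
  fmor_id : forall X, fmor (idm X) = idm (fob X);
  fmor_comp : forall X Y Z (g : hom Y Z) (f : hom X Y), fmor (g ∘ f) = fmor g ∘ fmor f
}.

Arguments fmor {A B} f0 {X Y} f : rename.

Section FunctorComp.
Variables A B C : preadditive.
Variables (G : functor B C) (F : functor A B).

Definition fcomp : functor A C.
Proof.
exists (fun X => G (F X)) (fun X Y f => fmor G (fmor F f)).
- by move=> X; rewrite !fmor_id.
- by move=> X Y Z g f; rewrite !fmor_comp.
Defined.

End FunctorComp.

Definition additive_functor (A B : preadditive) (F : functor A B) : Prop :=
  forall (X Y : A) (f g : hom X Y), fmor F (f + g) = fmor F f + fmor F g.

Record exact_functor (A B : preadditive) (F : functor A B) : Prop := ExactFunctor {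
  exact_additive : additive_functor F;
  exact_ses : forall (N G M : A) (i : hom N G) (p : hom G M),
    short_exact i p -> short_exact (fmor F i) (fmor F p)
}.

Record right_adjoint (A B : preadditive) (F : functor A B) := RightAdjoint {
  radj :> functor B A;
  unit_ : forall X : A, hom X (radj (F X));
  counit_ : forall Y : B, hom (F (radj Y)) Y;
  unit_nat : forall (X X' : A) (f : hom X X'),
    unit_ X' ∘ f = fmor radj (fmor F f) ∘ unit_ X;
  counit_nat : forall (Y Y' : B) (g : hom Y Y'),
    counit_ Y' ∘ fmor F (fmor radj g) = g ∘ counit_ Y;
  counit_unit : forall X : A, counit_ (F X) ∘ fmor F (unit_ X) = idm (F X);
  unit_counit : forall Y : B, fmor radj (counit_ Y) ∘ unit_ (radj Y) = idm (radj Y)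
}.

Lemma fmor_iso (A B : preadditive) (F : functor A B) (X Y : A) (f : hom X Y) :
  iso f -> iso (fmor F f).
Proof. by move=> [g [a b]]; exists (fmor F g); rewrite -!fmor_comp a b !fmor_id. Qed.

Lemma fmor0 (A B : preadditive) (F : functor A B) : additive_functor F ->
  forall X Y : A, fmor F (0 : hom X Y) = 0.
Proof. by move=> h X Y; apply: (addrI (fmor F 0)); rewrite -h !addr0. Qed.

Lemma fmorB (A B : preadditive) (F : functor A B) : additive_functor F ->
  forall (X Y : A) (f g : hom X Y), fmor F (f - g) = fmor F f - fmor F g.
Proof. by move=> h X Y f g; apply/eqP; rewrite eq_sym subr_eq -h subrK. Qed.

Section Adjunction.
Variables (A B : preadditive) (F : functor A B) (S : right_adjoint F).

Definition adj_r X Y (f : hom (F X) Y) : hom X (S Y) := fmor S f ∘ unit_ S X.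
Definition adj_l X Y (f : hom X (S Y)) : hom (F X) Y := counit_ S Y ∘ fmor F f.

Lemma adj_lK X Y (f : hom X (S Y)) : adj_r (adj_l f) = f.
Proof.
by rewrite /adj_r /adj_l fmor_comp -compA -unit_nat compA unit_counit comp1m.
Qed.

Lemma adj_rK X Y (f : hom (F X) Y) : adj_l (adj_r f) = f.
Proof.
by rewrite /adj_r /adj_l fmor_comp compA counit_nat -compA counit_unit compm1.
Qed.

Lemma adj_l_inj X Y (f g : hom X (S Y)) : adj_l f = adj_l g -> f = g.
Proof. by move=> e; rewrite -(adj_lK f) e adj_lK. Qed.

Lemma adj_r_inj X Y (f g : hom (F X) Y) : adj_r f = adj_r g -> f = g.
Proof. by move=> e; rewrite -(adj_rK f) e adj_rK. Qed.

Lemma adj_l_comp X X' Y (f : hom X (S Y)) (u : hom X' X) :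
  adj_l (f ∘ u) = adj_l f ∘ fmor F u.
Proof. by rewrite /adj_l fmor_comp compA. Qed.

Lemma adj_r_comp X X' Y (f : hom (F X) Y) (u : hom X' X) :
  adj_r (f ∘ fmor F u) = adj_r f ∘ u.
Proof. by rewrite /adj_r fmor_comp -compA -unit_nat compA. Qed.

Lemma adj_l_compl X Y Y' (f : hom X (S Y)) (u : hom Y Y') :
  adj_l (fmor S u ∘ f) = u ∘ adj_l f.
Proof. by rewrite /adj_l fmor_comp compA counit_nat compA. Qed.

Lemma adj_r_compl X Y Y' (f : hom (F X) Y) (u : hom Y Y') :
  adj_r (u ∘ f) = fmor S u ∘ adj_r f.
Proof. by rewrite /adj_r fmor_comp compA. Qed.

Lemma radj_additive : additive_functor F -> additive_functor S.
Proof.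
move=> h X Y f g; apply: adj_l_inj.
rewrite /adj_l h compmD.
by rewrite !counit_nat compDm.
Qed.

End Adjunction.

(* extensions of M by N: 0 -> N -> G -> M -> 0 *)
Record ext (A : preadditive) (M N : A) := Extension {
  ext_mid : A;
  ext_in : hom N ext_mid;
  ext_pr : hom ext_mid M;
  ext_exact : short_exact ext_in ext_pr
}.

(* chain morphisms with prescribed end components a : N -> N', c : M -> M' *)
Definition ext_mor (A : preadditive) (M N M' N' : A) (a : hom N N') (c : hom M M')
    (E : ext M N) (E' : ext M' N') : Prop :=
  exists b : hom (ext_mid E) (ext_mid E'),
    b ∘ ext_in E = ext_in E' ∘ a /\ ext_pr E' ∘ b = c ∘ ext_pr E.

Definition ext_rel (A : preadditive) (M N : A) (E E' : ext M N) : Prop :=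
  ext_mor (idm N) (idm M) E E'.

Definition Ext1 (A : abelianCat) (M N : A) : Type := quot (@ext_rel A M N).
HB.instance Definition _ (A : abelianCat) (M N : A) :=
  Choice.copy (Ext1 M N) (quot (@ext_rel A M N)).

Definition ext_class (A : abelianCat) (M N : A) (E : ext M N) : Ext1 M N :=
  class (@ext_rel A M N) E.

Definition ext_op (A : preadditive) (M N : A) (E : ext M N) : @ext (op A) N M :=
  @Extension (op A) N M (ext_mid E) (ext_pr E) (ext_in E)
    (conj (proj2 (ext_exact E)) (proj1 (ext_exact E))).

Definition op_ext (A : preadditive) (M N : A) (E : @ext (op A) N M) : ext M N :=
  @Extension A M N (ext_mid E) (ext_pr E) (ext_in E)
    (conj (proj2 (ext_exact E)) (proj1 (ext_exact E))).

Section ExtMor.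
Variable A : abelianCat.
Implicit Types M N K L : A.

Lemma ext_mor_op M N M' N' (a : hom N N') (c : hom M M') (E : ext M N) (E' : ext M' N') :
  ext_mor a c E E' <-> @ext_mor (op A) N' M' N M c a (ext_op E') (ext_op E).
Proof. by split=> -[b [h1 h2]]; exists b; split. Qed.

Lemma ext_mor_comp M N M' N' M'' N'' (a : hom N N') (c : hom M M')
    (a' : hom N' N'') (c' : hom M' M'') (E : ext M N) (E' : ext M' N') (E'' : ext M'' N'') :
  ext_mor a c E E' -> ext_mor a' c' E' E'' -> ext_mor (a' ∘ a) (c' ∘ c) E E''.
Proof.
move=> [b [h1 h2]] [b' [h1' h2']]; exists (b' ∘ b); split.
- by rewrite -compA h1 compA h1' compA.
- by rewrite compA h2' -compA h2 compA.
Qed.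

Lemma ext_rel_refl M N (E : ext M N) : ext_rel E E.
Proof. by exists (idm _); rewrite !comp1m !compm1. Qed.

Lemma ext_rel_mono M N (E E' : ext M N) b :
  b ∘ ext_in E = ext_in E' ∘ idm N -> ext_pr E' ∘ b = idm M ∘ ext_pr E -> mono b.
Proof.
rewrite compm1 comp1m => h1 h2; apply/mono0 => W g bg0.
have pg : ext_pr E ∘ g = 0 by rewrite -h2 -compA bg0 compm0.
have [u eu] := kernel_lift (proj1 (ext_exact E)) pg.
have : ext_in E' ∘ u = 0 by rewrite -h1 -compA eu bg0.
have /mono0 mE := kernel_mono (proj1 (ext_exact E')).
by move=> /mE u0; rewrite -eu u0 compm0.
Qed.

End ExtMor.

Section ExtMor2.
Variable A : abelianCat.
Implicit Types M N K L : A.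

Lemma ext_rel_sym M N (E E' : ext M N) : ext_rel E E' -> ext_rel E' E.
Proof.
move=> [b [h1 h2]]; have bm := ext_rel_mono h1 h2.
have be : epi b by apply: (@ext_rel_mono (opA A) _ _ (ext_op E') (ext_op E) b).
have [b' [e1 e2]] := mono_epi_iso bm be; exists b'; move: h1 h2.
rewrite !compm1 !comp1m => h1 h2; split.
- by rewrite -h1 compA e1 comp1m.
- by rewrite -h2 -compA e2 compm1.
Qed.

Lemma ext_rel_trans M N (E E' E'' : ext M N) :
  ext_rel E E' -> ext_rel E' E'' -> ext_rel E E''.
Proof. by move=> h h'; have := ext_mor_comp h h'; rewrite !comp1m. Qed.

Lemma ext_classE M N (E E' : ext M N) : ext_class E = ext_class E' <-> ext_rel E E'.
Proof.
apply: class_eq; [exact: ext_rel_refl | exact: ext_rel_sym | exact: ext_rel_trans].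
Qed.

Lemma ext_surj M N (e : Ext1 M N) : exists E, e = ext_class E.
Proof. exact: class_surj. Qed.

Lemma ext_pull_univ M N M' (c : hom M' M) (E : ext M N) : exists E' : ext M' N,
  ext_mor (idm N) c E' E /\ forall L K (F : ext L K) (a : hom K N) (d : hom L M'),
    ext_mor a (c ∘ d) F E -> ext_mor a d F E'.
Proof.
have [P [p [q hP]]] := pullback_ex (ext_pr E) c.
have [kE cE] := ext_exact E.
have [i hi pi] := pullback_kernel hP kE.
have qe : epi q by apply: pullback_epi hP (cokernel_epi cE).
exists (Extension (epi_ses qe hi)); split; first by exists p; rewrite compm1 (proj1 hP).
move=> L K F a d [b [h1 h2]].
have [|w [w1 w2]] := pullback_lift (u := b) (v := d ∘ ext_pr F) hP.
  by rewrite h2 compA.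
exists w; split=> //=; apply: (pullback_eq hP).
- by rewrite compA w1 h1 compA pi.
- by rewrite compA w2 -compA (proj1 (proj1 (ext_exact F))) compm0 compA (proj1 hi) comp0m.
Qed.

Lemma ext_pull_factor M N M' L K (c : hom M' M) (E : ext M N) (E' : ext M' N)
    (F : ext L K) (a : hom K N) (d : hom L M') :
  ext_mor (idm N) c E' E -> ext_mor a (c ∘ d) F E -> ext_mor a d F E'.
Proof.
move=> h hF; have [E0 [h0 u0]] := ext_pull_univ c E.
have e1 : ext_rel E' E0 by apply: u0; rewrite compm1.
by have := ext_mor_comp (u0 _ _ _ _ _ hF) (ext_rel_sym e1); rewrite !comp1m.
Qed.

Lemma ext_pull_ex M N M' (c : hom M' M) (E : ext M N) :
  exists E' : ext M' N, ext_mor (idm N) c E' E.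
Proof. by have [E' [h _]] := ext_pull_univ c E; exists E'. Qed.

End ExtMor2.

Section ExtPush.
Variable A : abelianCat.
Implicit Types M N K L : A.

Lemma ext_push_ex M N N' (a : hom N N') (E : ext M N) :
  exists E' : ext M N', ext_mor a (idm M) E E'.
Proof.
have [E' h] := @ext_pull_ex (opA A) _ _ N' a (ext_op E).
by exists (op_ext E'); case: h => b [h1 h2]; exists b.
Qed.

Lemma ext_push_factor M N N' L K (a : hom N N') (E : ext M N) (E' : ext M N')
    (F : ext L K) (d : hom M L) (b : hom N' K) :
  ext_mor a (idm M) E E' -> ext_mor (b ∘ a) d E F -> ext_mor b d E' F.
Proof.
move=> /ext_mor_op h /ext_mor_op hF; apply/ext_mor_op.
exact: (@ext_pull_factor (opA A) _ _ _ _ _ _ _ _ _ _ _ h hF).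
Qed.

Definition ext_pull M N M' (c : hom M' M) (e : Ext1 M N) : Ext1 M' N :=
  quot_lift (fun E => ext_class (projT1 (cid (ext_pull_ex c E)))) e.
Definition ext_push M N N' (a : hom N N') (e : Ext1 M N) : Ext1 M N' :=
  quot_lift (fun E => ext_class (projT1 (cid (ext_push_ex a E)))) e.

Lemma ext_pullE M N M' (c : hom M' M) (E : ext M N) (E' : ext M' N) :
  ext_mor (idm N) c E' E -> ext_pull c (ext_class E) = ext_class E'.
Proof.
move=> h; rewrite /ext_pull quot_liftE => [|{h E E'}E E' r].
  case: (cid _) => E'' /= h''; apply/ext_classE.
  by apply: (ext_pull_factor h); rewrite compm1.
case: (cid _) => F /= hF; case: (cid _) => F' /= hF'.
apply/ext_classE; apply: (ext_pull_factor hF'); rewrite compm1.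
by have := ext_mor_comp hF r; rewrite !comp1m.
Qed.

Lemma ext_pushE M N N' (a : hom N N') (E : ext M N) (E' : ext M N') :
  ext_mor a (idm M) E E' -> ext_push a (ext_class E) = ext_class E'.
Proof.
move=> h; rewrite /ext_push quot_liftE => [|{h E E'}E E' r].
  case: (cid _) => E'' /= h''; apply/ext_classE.
  by apply: (ext_push_factor h''); rewrite comp1m.
case: (cid _) => F /= hF; case: (cid _) => F' /= hF'.
apply/ext_classE; apply: (ext_push_factor hF); rewrite comp1m.
by have := ext_mor_comp r hF'; rewrite !compm1.
Qed.

Lemma ext_pull_mor M N M' (c : hom M' M) (E : ext M N) :
  exists2 E' : ext M' N, ext_pull c (ext_class E) = ext_class E' & ext_mor (idm N) c E' E.
Proof. by have [E' h] := ext_pull_ex c E; exists E' => //; apply: ext_pullE. Qed.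

Lemma ext_push_mor M N N' (a : hom N N') (E : ext M N) :
  exists2 E' : ext M N', ext_push a (ext_class E) = ext_class E' & ext_mor a (idm M) E E'.
Proof. by have [E' h] := ext_push_ex a E; exists E' => //; apply: ext_pushE. Qed.

Lemma ext_mor_push_pull M N M' N' (a : hom N N') (c : hom M M') (E : ext M N) (E' : ext M' N') :
  ext_mor a c E E' -> ext_push a (ext_class E) = ext_pull c (ext_class E').
Proof.
move=> h; have [F -> hF] := ext_pull_mor c E'.
by apply: ext_pushE; apply: (ext_pull_factor hF); rewrite compm1.
Qed.

Lemma ext_push_id M N (e : Ext1 M N) : ext_push (idm N) e = e.
Proof. by have [E ->] := ext_surj e; apply: ext_pushE; apply: ext_rel_refl. Qed.

Lemma ext_pull_id M N (e : Ext1 M N) : ext_pull (idm M) e = e.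
Proof. by have [E ->] := ext_surj e; apply: ext_pullE; apply: ext_rel_refl. Qed.

Lemma ext_push_comp M N N' N'' (a : hom N N') (b : hom N' N'') (e : Ext1 M N) :
  ext_push b (ext_push a e) = ext_push (b ∘ a) e.
Proof.
have [E ->] := ext_surj e; have [E' -> h] := ext_push_mor a E.
have [E'' -> h'] := ext_push_mor b E'; apply/esym/ext_pushE.
by have := ext_mor_comp h h'; rewrite comp1m.
Qed.

Lemma ext_pull_comp M M' M'' N (c : hom M' M) (d : hom M'' M') (e : Ext1 M N) :
  ext_pull d (ext_pull c e) = ext_pull (c ∘ d) e.
Proof.
have [E ->] := ext_surj e; have [E' -> h] := ext_pull_mor c E.
have [E'' -> h'] := ext_pull_mor d E'; apply/esym/ext_pullE.
by have := ext_mor_comp h' h; rewrite comp1m.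
Qed.

Lemma ext_push_pull M N M' N' (a : hom N N') (c : hom M' M) (e : Ext1 M N) :
  ext_push a (ext_pull c e) = ext_pull c (ext_push a e).
Proof.
have [E ->] := ext_surj e; have [E' -> h] := ext_pull_mor c E.
have [E'' -> h'] := ext_push_mor a E; apply: ext_mor_push_pull.
by have := ext_mor_comp h h'; rewrite compm1 comp1m.
Qed.

Record biproduct (X1 X2 : A) := Biproduct {
  bp_ob : A;
  bp_i1 : hom X1 bp_ob; bp_i2 : hom X2 bp_ob;
  bp_p1 : hom bp_ob X1; bp_p2 : hom bp_ob X2;
  bpP : is_biproduct bp_i1 bp_i2 bp_p1 bp_p2
}.

Lemma biproduct_exists X1 X2 : exists B : biproduct X1 X2, True.
Proof.
have [P [i1 [i2 [p1 [p2 h]]]]] := ab_biproduct (abelianCatP A) X1 X2.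
by exists (Biproduct h).
Qed.

Definition bip X1 X2 : biproduct X1 X2 := projT1 (cid (biproduct_exists X1 X2)).

(* the extension 0 -> N1 + N2 -> G1 x_M G2 -> M -> 0 *)
Lemma ext_fibre M N1 N2 (B : biproduct N1 N2) (E1 : ext M N1) (E2 : ext M N2) :
  exists F : ext M (bp_ob B), [/\ ext_mor (bp_p1 B) (idm M) F E1,
    ext_mor (bp_p2 B) (idm M) F E2
    & forall F' : ext M (bp_ob B), ext_mor (bp_p1 B) (idm M) F' E1 ->
        ext_mor (bp_p2 B) (idm M) F' E2 -> ext_rel F' F].
Proof.
have [P [q1 [q2 hP]]] := pullback_ex (ext_pr E1) (ext_pr E2).
have [k1 c1] := ext_exact E1; have [k2 c2] := ext_exact E2.
have [|i [i1 i2]] := pullback_lift (u := ext_in E1 ∘ bp_p1 B) (v := ext_in E2 ∘ bp_p2 B) hP.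
  by rewrite !compA (proj1 k1) (proj1 k2) !comp0m.
have [e11 e22 e12 e21 _] := bpP B.
have pe : epi (ext_pr E1 ∘ q1).
  apply: epi_comp (cokernel_epi c1) _.
  exact: pullback_epi (pullback_sym hP) (cokernel_epi c2).
have ki : is_kernel i (ext_pr E1 ∘ q1).
  apply: is_kernelI.
  - by rewrite -compA i1 compA (proj1 k1) comp0m.
  - apply/mono0 => W g g0; apply: (biproduct_eq (bpP B)); rewrite compm0.
    + by apply: (kernel_mono k1); rewrite compA -i1 -compA g0 !compm0.
    + by apply: (kernel_mono k2); rewrite compA -i2 -compA g0 !compm0.
  - move=> W g g0; have [|a ea] := kernel_lift (g := q1 ∘ g) k1; first by rewrite compA.
    have [|b eb] := kernel_lift (g := q2 ∘ g) k2; first by rewrite compA -(proj1 hP).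
    exists (bp_i1 B ∘ a + bp_i2 B ∘ b); apply: (pullback_eq hP).
    + rewrite compA i1 -compA compmD !compA e11 e12 comp1m comp0m addr0; exact: ea.
    + rewrite compA i2 -compA compmD !compA e21 e22 comp1m comp0m add0r; exact: eb.
exists (Extension (epi_ses pe ki)); split.
- by exists q1; rewrite comp1m.
- by exists q2; rewrite comp1m; split=> //=; rewrite (proj1 hP).
- move=> F' [b1 [h1 h1']] [b2 [h2 h2']].
  have [|w [w1 w2]] := pullback_lift (u := b1) (v := b2) hP; first by rewrite h1' h2'.
  exists w; rewrite compm1 /=; split; last by rewrite -compA w1.
  apply: (pullback_eq hP).
  + by rewrite compA w1 h1 i1.
  + by rewrite compA w2 h2 i2.
Qed.

Lemma ext_pair M N1 N2 (B : biproduct N1 N2) (e1 : Ext1 M N1) (e2 : Ext1 M N2) :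
  exists f : Ext1 M (bp_ob B), ext_push (bp_p1 B) f = e1 /\ ext_push (bp_p2 B) f = e2.
Proof.
have [E1 ->] := ext_surj e1; have [E2 ->] := ext_surj e2.
have [F [h1 h2 _]] := ext_fibre B E1 E2.
by exists (ext_class F); rewrite (ext_pushE h1) (ext_pushE h2).
Qed.

Lemma ext_pair_inj M N1 N2 (B : biproduct N1 N2) (f f' : Ext1 M (bp_ob B)) :
  ext_push (bp_p1 B) f = ext_push (bp_p1 B) f' ->
  ext_push (bp_p2 B) f = ext_push (bp_p2 B) f' -> f = f'.
Proof.
have [F ->] := ext_surj f; have [F' ->] := ext_surj f'.
have [E1 -> h1] := ext_push_mor (bp_p1 B) F; have [E2 -> h2] := ext_push_mor (bp_p2 B) F.
have [E1' -> h1'] := ext_push_mor (bp_p1 B) F'.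
have [E2' -> h2'] := ext_push_mor (bp_p2 B) F'.
move=> /esym/ext_classE r1 /esym/ext_classE r2; have [G [_ _ u]] := ext_fibre B E1 E2.
apply/ext_classE; apply: ext_rel_trans (u _ h1 h2) _; apply: ext_rel_sym; apply: u.
- by have := ext_mor_comp h1' r1; rewrite !comp1m.
- by have := ext_mor_comp h2' r2; rewrite !comp1m.
Qed.

(* Baer sum: the pushout along the codiagonal p1 + p2 : N + N -> N of the
   class of 0 -> N + N -> G1 x_M G2 -> M -> 0, which is the only class with
   pushouts e1 and e2 along the projections *)
Definition baer_sum M N (e1 e2 : Ext1 M N) : Ext1 M N :=
  ext_push (bp_p1 (bip N N) + bp_p2 (bip N N)) (projT1 (cid (ext_pair (bip N N) e1 e2))).

Lemma ext_pushD M K N (a b : hom K N) (f : Ext1 M K) :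
  ext_push (a + b) f = baer_sum (ext_push a f) (ext_push b f).
Proof.
rewrite /baer_sum; case: (cid _) => g /= [g1 g2].
set B := bip N N in g g1 g2 *; have [e11 e22 e12 e21 _] := bpP B.
pose t : hom K (bp_ob B) := bp_i1 B ∘ a + bp_i2 B ∘ b.
have t1 : bp_p1 B ∘ t = a by rewrite compmD !compA e11 e12 comp1m comp0m addr0.
have t2 : bp_p2 B ∘ t = b by rewrite compmD !compA e21 e22 comp1m comp0m add0r.
have -> : g = ext_push t f.
  by apply: ext_pair_inj; rewrite ext_push_comp ?t1 ?t2.
by rewrite ext_push_comp compDm t1 t2.
Qed.

Lemma split_short_exact M N : short_exact (bp_i1 (bip N M)) (bp_p2 (bip N M)).
Proof.
have [e11 e22 e12 e21 e] := bpP (bip N M).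
split.
  apply: is_kernelI => // [|W g g0].
    by apply: (mono_compr (g := bp_p1 (bip N M))); rewrite e11; apply: mono_id.
  by exists (bp_p1 (bip N M) ∘ g); rewrite -{2}(comp1m g) -e compDm -!compA g0 compm0 addr0.
apply: is_cokernelI => // [|W g g0].
  by apply: (epi_compl (f := bp_i2 (bip N M))); rewrite e22; apply: epi_id.
by exists (g ∘ bp_i2 (bip N M)); rewrite -{2}(compm1 g) -e compmD !compA g0 comp0m add0r.
Qed.

Definition ext_zero M N : Ext1 M N := ext_class (Extension (split_short_exact M N)).

Lemma ext_push0 M K N (f : Ext1 M K) : ext_push (0 : hom K N) f = ext_zero M N.
Proof.
have [F ->] := ext_surj f; apply: ext_pushE; have [_ e22 _ _ _] := bpP (bip N M).
exists (bp_i2 (bip N M) ∘ ext_pr F); split=> /=.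
  by rewrite -compA (proj1 (proj1 (ext_exact F))) !compm0.
by rewrite compA e22.
Qed.

Definition ext_opp M N (e : Ext1 M N) : Ext1 M N := ext_push (- idm N) e.

Lemma ext_addA M N : associative (@baer_sum M N).
Proof.
move=> e1 e2 e3.
have [f [<- h2]] := ext_pair (bip N N) e1 e2; rewrite -{}h2.
have [g [<- <-]] := ext_pair (bip _ N) f e3.
by rewrite !ext_push_comp -!ext_pushD addrA.
Qed.

Lemma ext_addC M N : commutative (@baer_sum M N).
Proof.
by move=> e1 e2; have [f [<- <-]] := ext_pair (bip N N) e1 e2; rewrite -!ext_pushD addrC.
Qed.

Lemma ext_add0 M N : left_id (ext_zero M N) (@baer_sum M N).
Proof. by move=> e; rewrite -{1}(ext_push_id e) -(ext_push0 N e) -ext_pushD add0r ext_push_id. Qed.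

Lemma ext_addN M N : left_inverse (ext_zero M N) (@ext_opp M N) (@baer_sum M N).
Proof.
by move=> e; rewrite -{2}(ext_push_id e) -ext_pushD addNr ext_push0.
Qed.

HB.instance Definition _ M N :=
  GRing.isZmodule.Build (Ext1 M N) (@ext_addA M N) (@ext_addC M N) (@ext_add0 M N) (@ext_addN M N).

Lemma ext_addE M K N (a b : hom K N) (f : Ext1 M K) :
  ext_push a f + ext_push b f = ext_push (a + b) f.
Proof. exact/esym/ext_pushD. Qed.

Lemma zmod_morphismD (U V : zmodType) (f : U -> V) :
  (forall x y, f (x + y) = f x + f y) -> zmod_morphism f.
Proof. by move=> h x y; apply/eqP; rewrite eq_sym subr_eq -h subrK. Qed.

Lemma ext_pull_additive M N M' (c : hom M' M) : zmod_morphism (@ext_pull M N M' c).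
Proof.
apply: zmod_morphismD => e1 e2; have [f [<- <-]] := ext_pair (bip N N) e1 e2.
by rewrite ext_addE -!ext_push_pull ext_addE.
Qed.

Lemma ext_push_additive M N N' (a : hom N N') : zmod_morphism (@ext_push M N N' a).
Proof.
apply: zmod_morphismD => e1 e2; have [f [<- <-]] := ext_pair (bip N N) e1 e2.
by rewrite ext_addE !ext_push_comp ext_addE compmD.
Qed.

HB.instance Definition _ M N M' (c : hom M' M) :=
  GRing.isZmodMorphism.Build (Ext1 M N) (Ext1 M' N) (@ext_pull M N M' c) (@ext_pull_additive M N M' c).
HB.instance Definition _ M N N' (a : hom N N') :=
  GRing.isZmodMorphism.Build (Ext1 M N) (Ext1 M N') (@ext_push M N N' a) (@ext_push_additive M N N' a).

End ExtPush.

Section ExtMap.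
Variables (A B : abelianCat) (F : functor A B) (exF : exact_functor F).
Implicit Types M N : A.

Definition map_ext M N (E : ext M N) : ext (F M) (F N) :=
  Extension (exact_ses exF (ext_exact E)).

Definition Ext1_map M N (e : Ext1 M N) : Ext1 (F M) (F N) :=
  quot_lift (fun E => ext_class (map_ext E)) e.

Lemma map_ext_mor M N M' N' (a : hom N N') (c : hom M M') (E : ext M N) (E' : ext M' N') :
  ext_mor a c E E' -> ext_mor (fmor F a) (fmor F c) (map_ext E) (map_ext E').
Proof. by move=> [b [h1 h2]]; exists (fmor F b); rewrite -!fmor_comp h1 h2. Qed.

Lemma Ext1_mapE M N (E : ext M N) : Ext1_map (ext_class E) = ext_class (map_ext E).
Proof.
apply: quot_liftE => {}E E' h; apply/ext_classE.
by have := map_ext_mor h; rewrite !fmor_id.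
Qed.

Lemma Ext1_map_push M N N' (a : hom N N') (e : Ext1 M N) :
  Ext1_map (ext_push a e) = ext_push (fmor F a) (Ext1_map e).
Proof.
have [E ->] := ext_surj e; have [E' -> h] := ext_push_mor a E.
rewrite !Ext1_mapE; apply/esym/ext_pushE.
by have := map_ext_mor h; rewrite fmor_id.
Qed.

Lemma Ext1_map_pull M N M' (c : hom M' M) (e : Ext1 M N) :
  Ext1_map (ext_pull c e) = ext_pull (fmor F c) (Ext1_map e).
Proof.
have [E ->] := ext_surj e; have [E' -> h] := ext_pull_mor c E.
rewrite !Ext1_mapE; apply/esym/ext_pullE.
by have := map_ext_mor h; rewrite fmor_id.
Qed.

Lemma Ext1_map_additive M N : zmod_morphism (@Ext1_map M N).
Proof.
apply: zmod_morphismD => e1 e2; have [f [<- <-]] := ext_pair (bip N N) e1 e2.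
by rewrite ext_addE !Ext1_map_push ext_addE (exact_additive exF).
Qed.

HB.instance Definition _ M N :=
  GRing.isZmodMorphism.Build (Ext1 M N) (Ext1 (F M) (F N)) (@Ext1_map M N) (@Ext1_map_additive M N).

End ExtMap.

(* a full subcategory, given by its objects *)
Record thick (A : abelianCat) := Thick {
  th_mem :> A -> Prop;
  th_nonempty : exists X, th_mem X;
  th_sub : forall (X Y : A) (f : hom X Y), mono f -> th_mem Y -> th_mem X;
  th_factor : forall (X Y : A) (f : hom X Y), epi f -> th_mem X -> th_mem Y;
  th_ext : forall (N G M : A) (i : hom N G) (p : hom G M),
    short_exact i p -> th_mem N -> th_mem M -> th_mem G
}.

Definition op_thick (A : abelianCat) (C : thick A) : thick (opA A).
Proof.
refine (@Thick (opA A) (th_mem C) _ _ _ _).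
- exact: (@th_nonempty A C).
- by move=> X Y f; apply: (@th_factor A C).
- by move=> X Y f; apply: (@th_sub A C).
- move=> N G M i p [h1 h2] hN hM; exact: (@th_ext A C M G N p i (conj h2 h1)).
Defined.

Record subobject (A : preadditive) (M : A) := Subobject {
  so_ob :> A;
  so_mor : hom so_ob M;
  so_mono : mono so_mor
}.

Arguments so_mor {A M} s.
Arguments so_mono {A M} s [W g h] _.

Definition sub_le (A : preadditive) (M : A) (i j : subobject M) : Prop :=
  exists u : hom i j, so_mor i = so_mor j ∘ u.

Definition sub_incl (A : preadditive) (M : A) (i j : subobject M) (h : sub_le i j) :
  hom i j := projT1 (cid h).

Lemma sub_inclP (A : preadditive) (M : A) (i j : subobject M) (h : sub_le i j) :
  so_mor j ∘ sub_incl h = so_mor i.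
Proof. by rewrite /sub_incl; case: (cid h). Qed.

Lemma sub_le_refl (A : preadditive) (M : A) (i : subobject M) : sub_le i i.
Proof. by exists (idm _); rewrite compm1. Qed.

Lemma sub_le_trans (A : preadditive) (M : A) (i j k : subobject M) :
  sub_le i j -> sub_le j k -> sub_le i k.
Proof. by move=> [u e] [v e']; exists (v ∘ u); rewrite compA -e' e. Qed.

Lemma sub_incl_id (A : preadditive) (M : A) (i : subobject M) (h : sub_le i i) :
  sub_incl h = idm i.
Proof. by apply: (so_mono i); rewrite sub_inclP compm1. Qed.

Lemma sub_incl_comp (A : preadditive) (M : A) (i j k : subobject M)
    (h : sub_le i j) (h' : sub_le j k) (h'' : sub_le i k) :
  sub_incl h' ∘ sub_incl h = sub_incl h''.
Proof. by apply: (so_mono k); rewrite compA !sub_inclP. Qed.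

Section QuotientObjects.
Variable A : abelianCat.

(* the quotient N/n *)
Definition factor_ob (N : A) (n : subobject N) : A := coker_ob (so_mor n).
Definition factor_pr (N : A) (n : subobject N) : hom N (factor_ob n) := coker (so_mor n).

Lemma factor_map_ex (N : A) (n n' : subobject N) (h : sub_le n n') :
  exists q : hom (factor_ob n) (factor_ob n'), q ∘ factor_pr n = factor_pr n'.
Proof.
apply: (cokernel_desc (cokerP _)); have [u ->] := h.
by rewrite compA coker0 comp0m.
Qed.

Lemma factor_pr_epi (N : A) (n : subobject N) : epi (factor_pr n).
Proof. exact: coker_epi. Qed.

Definition factor_map (N : A) (n n' : subobject N) (h : sub_le n n') :
  hom (factor_ob n) (factor_ob n') := projT1 (cid (factor_map_ex h)).

Lemma factor_mapP (N : A) (n n' : subobject N) (h : sub_le n n') :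
  factor_map h ∘ factor_pr n = factor_pr n'.
Proof. by rewrite /factor_map; case: (cid _). Qed.

Lemma factor_map_id (N : A) (n : subobject N) (h : sub_le n n) :
  factor_map h = idm _.
Proof. by apply: factor_pr_epi; rewrite factor_mapP comp1m. Qed.

Lemma factor_map_comp (N : A) (n n' n'' : subobject N)
    (h : sub_le n n') (h' : sub_le n' n'') (h'' : sub_le n n'') :
  factor_map h' ∘ factor_map h = factor_map h''.
Proof.
by apply: factor_pr_epi; rewrite -compA !factor_mapP.
Qed.

End QuotientObjects.

Section ThickTheory.
Variables (A : abelianCat) (C : thick A).
Implicit Types X Y Z M N : A.

(* subobjects M' <= M with M/M' in C, and subobjects N' <= N with N' in C *)
Record cosubobject M := Cosubobject {
  cs_sub :> subobject M;
  csP : C (factor_ob cs_sub)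
}.
Record insubobject N := Insubobject {
  ns_sub :> subobject N;
  nsP : C (so_ob ns_sub)
}.

Lemma th_iso X Y (f : hom X Y) : iso f -> C Y -> C X.
Proof. by move=> /iso_mono; apply: th_sub. Qed.

Lemma th_zero Z : zero_ob Z -> C Z.
Proof.
move=> hZ; have [X hX] := th_nonempty C.
by apply: (th_sub (f := (0 : hom Z X))) hX => W g h _; apply: (proj2 hZ).
Qed.

Definition Ciso X Y (s : hom X Y) : Prop :=
  (exists K (k : hom K X), is_kernel k s /\ C K) /\
  (exists Q (c : hom Y Q), is_cokernel c s /\ C Q).

Lemma Ciso_ker X Y K (s : hom X Y) (k : hom K X) : Ciso s -> is_kernel k s -> C K.
Proof.
by move=> [[K' [k' [hk' hC]]] _] hk; have [u hu _] := kernel_iso hk hk'; apply: th_iso hu hC.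
Qed.

Lemma th_mid X Y K (k : hom K X) (f : hom X Y) : is_kernel k f -> C K -> C Y -> C X.
Proof.
move=> hk hK hY; have [I [m [e [hm he ef]]]] := image f.
rewrite ef in hk; move/(kernel_monol _ _ hm) in hk.
apply: (th_ext (epi_ses he hk)) => //; exact: th_sub hm hY.
Qed.

Lemma zero_kernel X Y (f : hom X Y) (Z : A) : zero_ob Z -> mono f ->
  is_kernel (0 : hom Z X) f.
Proof.
move=> [h1 h2] hf; apply: is_kernelI; first by rewrite compm0.
- by move=> W g h _; apply: h2.
- by move=> W g g0; exists 0; rewrite compm0; apply/esym/(proj1 (mono0 f) hf).
Qed.

Lemma Ciso_mono X Y Q (m : hom X Y) (c : hom Y Q) :
  mono m -> is_cokernel c m -> C Q -> Ciso m.
Proof.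
move=> hm hc hQ; split; last by exists Q, c.
have [Z hZ] := zeroP A; exists Z, 0; split; first exact: zero_kernel.
exact: th_zero.
Qed.

Lemma comp_ker X Y Z (s : hom X Y) (t : hom Y Z) :
  (exists K (k : hom K X), is_kernel k s /\ C K) ->
  (exists K (k : hom K Y), is_kernel k t /\ C K) ->
  (exists K (k : hom K X), is_kernel k (t ∘ s) /\ C K).
Proof.
move=> [K [k [hk hK]]] [L [l [hl hL]]].
have hts := kerP (t ∘ s).
have [|v ev] := kernel_lift (g := s ∘ ker (t ∘ s)) hl.
  by rewrite compA ker0.
have [|j ej] := kernel_lift (g := k) hts.
  by rewrite -compA (proj1 hk) compm0.
exists _, (ker (t ∘ s)); split=> //; apply: (th_mid (k := j) (f := v)) => //.
apply: is_kernelI.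
- by apply: (kernel_mono hl); rewrite compA ev -compA ej (proj1 hk) compm0.
- by apply: (mono_compr (g := ker (t ∘ s))); rewrite ej; apply: kernel_mono hk.
- move=> W g vg; have [|w ew] := kernel_lift (g := ker (t ∘ s) ∘ g) hk.
    by rewrite compA -ev -compA vg compm0.
  by exists w; apply: (kernel_mono hts); rewrite compA ej ew.
Qed.

Lemma kernel_Ciso X D K (f : hom X D) (k : hom K X) : C D -> is_kernel k f -> Ciso k.
Proof.
move=> hD hk; have [I [m [e [hm he ef]]]] := image f.
rewrite ef in hk; move/(kernel_monol _ _ hm) in hk.
apply: (Ciso_mono (c := e) (kernel_mono hk)); first exact: epi_cokernel.
exact: th_sub hm hD.
Qed.

Lemma pullback_coker X Y Z P (s : hom X Z) (g : hom Y Z) (p : hom P X) (q : hom P Y) :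
  is_pullback s g p q ->
  (exists Q (c : hom Z Q), is_cokernel c s /\ C Q) ->
  (exists Q (c : hom Y Q), is_cokernel c q /\ C Q).
Proof.
move=> hP [Q [c [hc hQ]]].
have [I [m [e [hm he es]]]] := image s.
rewrite es in hc; move/(cokernel_epir _ _ he) in hc.
have hk := mono_kernel hm hc.
have [P1 [p1 [q1 hP1]]] := pullback_ex m g.
have [|r [r1 r2]] := pullback_lift (u := e ∘ p) (v := q) hP1.
  by rewrite compA -es (proj1 hP).
have hPr : is_pullback e p1 p r.
  split=> // W u v euv.
  have [|w [w1 w2]] := pullback_lift (u := u) (v := q1 ∘ v) hP.
    by rewrite es -compA euv !compA (proj1 hP1).
  exists w; split.
    split=> //; apply: (pullback_eq hP1); last by rewrite compA r2.
    by rewrite compA r1 -compA w1.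
  move=> w' [w1' w2']; apply: (pullback_eq hP); first by rewrite w1.
  by rewrite w2 -w2' compA r2.
have er : epi r := pullback_epi hPr he.
have k1 : is_kernel q1 (c ∘ g).
  apply: is_kernelI.
  - by rewrite -compA -(proj1 hP1) compA (proj1 hk) comp0m.
  - exact: pullback_mono hP1 hm.
  - move=> W u; rewrite -compA => /(kernel_lift hk)[v ev].
    by have [w [_ ew]] := pullback_lift hP1 ev; exists w.
have [J [n [d [hn hd end_]]]] := image (c ∘ g).
rewrite end_ in k1; move/(kernel_monol _ _ hn) in k1.
exists J, d; split; last exact: th_sub hn hQ.
by rewrite -r2; apply/(cokernel_epir _ _ er); apply: epi_cokernel.
Qed.

End ThickTheory.

Section CisoTheory.
Variables (A : abelianCat) (C : thick A).
Implicit Types X Y Z M N : A.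

Lemma Ciso_op X Y (s : hom X Y) : Ciso C s <-> @Ciso (opA A) (op_thick C) Y X s.
Proof. by split=> -[h1 h2]. Qed.

Lemma Ciso_comp X Y Z (s : hom X Y) (t : hom Y Z) : Ciso C s -> Ciso C t -> Ciso C (t ∘ s).
Proof.
move=> [s1 s2] [t1 t2]; split; first exact: comp_ker.
exact: (@comp_ker (opA A) (op_thick C) _ _ _ t s).
Qed.

Lemma Ciso_pullback X Y Z P (s : hom X Z) (g : hom Y Z) (p : hom P X) (q : hom P Y) :
  is_pullback s g p q -> Ciso C s -> Ciso C q.
Proof.
move=> hP [[K [k [hk hC]]] hc]; split; last exact: pullback_coker hP hc.
by have [k' hk' _] := pullback_kernel hP hk; exists K, k'.
Qed.

End CisoTheory.

Section SerreQuotient.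
Variables (A : abelianCat) (C : thick A).
Implicit Types X Y Z M N P : A.

Lemma Ciso_pushout X Y Z P (f : hom Z X) (g : hom Z Y) (p : hom X P) (q : hom Y P) :
  is_pushout f g p q -> Ciso C f -> Ciso C q.
Proof.
move=> hP /Ciso_op hf; apply/Ciso_op.
exact: (@Ciso_pullback (opA A) (op_thick C) _ _ _ _ f g p q hP hf).
Qed.

Lemma cokernel_Ciso X D Q (f : hom D X) (c : hom X Q) : C D -> is_cokernel c f -> Ciso C c.
Proof. by move=> hD hc; apply/Ciso_op; apply: (@kernel_Ciso (opA A) (op_thick C)) hc. Qed.

Lemma Ciso_epi X Y K (e : hom X Y) (k : hom K X) :
  epi e -> is_kernel k e -> C K -> Ciso C e.
Proof. by move=> he hk hK; apply/Ciso_op; apply: (@Ciso_mono (opA A) (op_thick C) _ _ K e k). Qed.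

Lemma Ciso_coker X Y Q (s : hom X Y) (c : hom Y Q) : Ciso C s -> is_cokernel c s -> C Q.
Proof. by move=> /Ciso_op; apply: Ciso_ker. Qed.

Lemma Ciso_id X : Ciso C (idm X).
Proof.
have [Z hZ] := zeroP A.
apply: (Ciso_mono (c := (0 : hom X Z))); [exact: (@mono_id A X) | | exact: th_zero].
by apply: (@zero_kernel (opA A)); [apply: op_zero | apply: (@mono_id (op A))].
Qed.

Lemma cosub_Ciso M (i : cosubobject C M) : Ciso C (so_mor i).
Proof. exact: Ciso_mono (so_mono i) (cokerP _) (csP i). Qed.

Lemma insub_Ciso N (n : insubobject C N) : Ciso C (factor_pr n).
Proof.
exact: (Ciso_epi (@factor_pr_epi _ _ n) (mono_kernel (so_mono n) (cokerP _)) (nsP n)).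
Qed.

Definition cosub_of M X (i : hom X M) (h : mono i) (w : Ciso C i) : cosubobject C M :=
  @Cosubobject A C M (Subobject h) (Ciso_coker w (cokerP i)).

Lemma cosub_directed M (i j : cosubobject C M) :
  exists k : cosubobject C M, sub_le k i /\ sub_le k j.
Proof.
have [P [p [q hP]]] := pullback_ex (so_mor i) (so_mor j).
have hq : mono q := pullback_mono hP (so_mono i).
have wq : Ciso C q := Ciso_pullback hP (cosub_Ciso i).
exists (cosub_of (mono_comp (so_mono j) hq) (Ciso_comp wq (cosub_Ciso j))).
by split; [exists p; rewrite /= (proj1 hP) | exists q].
Qed.

Definition cosub_top M : cosubobject C M := cosub_of (@mono_id A M) (Ciso_id M).

Lemma insub_directed N (i j : insubobject C N) :
  exists k : insubobject C N, sub_le i k /\ sub_le j k.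
Proof.
have [P [p [q hP]]] := pushout_ex (factor_pr i) (factor_pr j).
have wd : Ciso C (q ∘ factor_pr j).
  exact: Ciso_comp (insub_Ciso j) (Ciso_pushout hP (insub_Ciso i)).
have hk := kerP (q ∘ factor_pr j).
exists (@Insubobject A C N (Subobject (@ker_mono _ _ _ (q ∘ factor_pr j))) (Ciso_ker wd hk)); split.
- have [|u eu] := kernel_lift (g := so_mor i) hk.
    by rewrite -(proj1 hP) -compA coker0 compm0.
  by exists u; rewrite /= eu.
- have [|u eu] := kernel_lift (g := so_mor j) hk.
    by rewrite -compA coker0 compm0.
  by exists u; rewrite /= eu.
Qed.

Lemma zero_mono (Z N : A) : zero_ob Z -> mono (0 : hom Z N).
Proof. by move=> [_ h] W f g _; apply: h. Qed.

Definition insub_bot N : insubobject C N :=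
  @Insubobject A C N (Subobject (@zero_mono _ N (projT2 (zeroP A)))) (th_zero C (projT2 (zeroP A))).

(* the system Hom_A(M', N/N') over M/M' and N' in C, ordered by shrinking M'
   and enlarging N' *)
Section HomSystem.
Variables M N : A.

Definition qhom_index : Type := (cosubobject C M * insubobject C N)%type.
Definition qhom_le (x y : qhom_index) : Prop := sub_le y.1 x.1 /\ sub_le x.2 y.2.
Definition qhom_obj (x : qhom_index) : zmodType := hom (so_ob x.1) (factor_ob x.2).
Definition qhom_map (x y : qhom_index) (h : qhom_le x y) (f : qhom_obj x) : qhom_obj y :=
  factor_map (proj2 h) ∘ f ∘ sub_incl (proj1 h).

Lemma qhom_map_additive x y (h : qhom_le x y) : zmod_morphism (qhom_map h).
Proof. by move=> f g; rewrite /qhom_map compmB compBm. Qed.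

HB.instance Definition _ x y (h : qhom_le x y) :=
  GRing.isZmodMorphism.Build (qhom_obj x) (qhom_obj y) (qhom_map h) (qhom_map_additive h).

Definition qhom_system : directSystem.
Proof.
refine (@DirectSystem qhom_index qhom_le _ _ _ _ qhom_obj (fun x y h => qhom_map h) _ _).
- by move=> x; split; apply: sub_le_refl.
- by move=> x y z [h1 h2] [h3 h4]; split; [apply: sub_le_trans h3 h1 | apply: sub_le_trans h2 h4].
- move=> x y; have [k1 [a b]] := cosub_directed x.1 y.1.
  by have [k2 [c d]] := insub_directed x.2 y.2; exists (k1, k2).
- by exists (cosub_top M, insub_bot N).
- by move=> x h f; rewrite /= /qhom_map factor_map_id sub_incl_id comp1m compm1.
- move=> x y z h h' h'' f; rewrite /= /qhom_map.
  by rewrite -(factor_map_comp (proj2 h) (proj2 h')) -(sub_incl_comp (proj1 h') (proj1 h)) !compA.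
Defined.

Definition qhom : zmodType := dirlim qhom_system.

Definition qclass (i : cosubobject C M) (n : insubobject C N) (f : hom i (factor_ob n)) : qhom :=
  @dl_in qhom_system (i, n) f.

End HomSystem.

Lemma qclass_ex M N (a : qhom M N) : exists (i : cosubobject C M) (n : insubobject C N)
  (f : hom i (factor_ob n)), a = qclass f.
Proof. by have [[i n] [f ->]] := dl_surj a; exists i, n, f. Qed.

Lemma qclass_map M N (i i' : cosubobject C M) (n n' : insubobject C N)
    (f : hom i (factor_ob n)) (h : sub_le i' i) (h' : sub_le n n') :
  qclass (factor_map h' ∘ f ∘ sub_incl h) = qclass f.
Proof.
pose hh : @ds_le (qhom_system M N) (i, n) (i', n') := conj h h'.
etransitivity; last exact: (@dl_in_map (qhom_system M N) (i, n) (i', n') hh f).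
apply: congr1; rewrite [RHS]/= /qhom_map.
by rewrite (Prop_irrelevance (proj1 hh) h) (Prop_irrelevance (proj2 hh) h').
Qed.

Lemma qclassD M N (i : cosubobject C M) (n : insubobject C N) (f g : hom i (factor_ob n)) :
  qclass (f + g) = qclass f + qclass g.
Proof. exact: (@dl_inD (qhom_system M N) (i, n)). Qed.

Lemma qclass0 M N (i : cosubobject C M) (n : insubobject C N) (f : hom i (factor_ob n)) :
  qclass f = 0 -> exists (i' : cosubobject C M) (n' : insubobject C N)
    (h : sub_le i' i) (h' : sub_le n n'), factor_map h' ∘ f ∘ sub_incl h = 0.
Proof.
rewrite -(@dl_in0 (qhom_system M N) (i, n)) => /dl_eq[[i' n'] [h [h' e]]].
by exists i', n', (proj1 h), (proj2 h); apply: (etrans e); rewrite raddf0.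
Qed.

(* If a is the class of f : M' -> N/N', then [fracof s u a] says that s factors
   through M' and that f and u agree on X modulo N'.  For s with kernel and
   cokernel in C this determines a, namely a = Q(u) Q(s)^-1. *)
Definition fracof M N X (s : hom X M) (u : hom X N) (a : qhom M N) : Prop :=
  exists (i : cosubobject C M) (n : insubobject C N) (f : hom i (factor_ob n)) (m : hom X i),
    [/\ a = qclass f, so_mor i ∘ m = s & f ∘ m = factor_pr n ∘ u].

Lemma frac_ex M N (a : qhom M N) : exists X (s : hom X M) (u : hom X N),
  Ciso C s /\ fracof s u a.
Proof.
have [i [n [f ->]]] := qclass_ex a.
have [X [q [p hP]]] := pullback_ex (factor_pr n) f.
exists X, (so_mor i ∘ p), q; split; last by exists i, n, f, p; rewrite (proj1 hP).
exact: Ciso_comp (Ciso_pullback hP (insub_Ciso n)) (cosub_Ciso i).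
Qed.

Lemma frac_comp M N X Y (s : hom X M) (u : hom X N) (c : hom Y X) a :
  fracof s u a -> fracof (s ∘ c) (u ∘ c) a.
Proof.
by move=> [i [n [f [m [-> <- e]]]]]; exists i, n, f, (m ∘ c); rewrite !compA e.
Qed.

Lemma Ciso_image M X (s : hom X M) : Ciso C s ->
  exists (i : cosubobject C M) (m : hom X i), epi m /\ so_mor i ∘ m = s.
Proof.
move=> [_ [Q [c [hc hQ]]]]; have [I [i [m [hi hm e]]]] := image s.
rewrite e in hc; move/(cokernel_epir _ _ hm) in hc.
by exists (cosub_of hi (Ciso_mono hi hc hQ)), m.
Qed.

Lemma image_insub D N (f : hom D N) : C D ->
  exists (n : insubobject C N) (m : hom D n), so_mor n ∘ m = f.
Proof.
move=> hD; have [I [i [m [hi hm ->]]]] := image f.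
by exists (@Insubobject A C N (Subobject hi) (th_factor hm hD)), m.
Qed.

Lemma frac_build M N X (s : hom X M) (u : hom X N) : Ciso C s -> exists a, fracof s u a.
Proof.
move=> ws; have [i [m [hm e]]] := Ciso_image ws.
have hk := kerP m.
have hks : is_kernel (ker m) s.
  by rewrite -e; apply/(kernel_monol _ _ (so_mono i)).
have [n [v ev]] := image_insub (u ∘ ker m) (Ciso_ker ws hks).
have [|f ef] := cokernel_desc (g := factor_pr n ∘ u) (epi_cokernel hm hk).
  by rewrite -compA -ev compA coker0 comp0m.
by exists (qclass f), i, n, f, m.
Qed.

Lemma frac_at M N X (s : hom X M) (u : hom X N) (i0 : cosubobject C M) (m0 : hom X i0)
    (i : cosubobject C M) (n n' : insubobject C N) (f : hom i (factor_ob n)) (m : hom X i) :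
  epi m0 -> so_mor i0 ∘ m0 = s -> so_mor i ∘ m = s -> f ∘ m = factor_pr n ∘ u ->
  sub_le n n' -> exists2 f' : hom i0 (factor_ob n'), qclass f = qclass f' & f' ∘ m0 = factor_pr n' ∘ u.
Proof.
move=> he e0 e1 e2 h.
have [|w ew] := cokernel_desc (g := m) (epi_cokernel he (kerP m0)).
  apply: (so_mono i); rewrite compA e1 -e0 -compA ker0 !compm0 //.
have hi : sub_le i0 i.
  by exists w; apply: he; rewrite e0 -compA ew e1.
exists (factor_map h ∘ f ∘ sub_incl hi); first by rewrite qclass_map.
have -> : sub_incl hi = w.
  by apply: (so_mono i); rewrite sub_inclP; apply: he; rewrite e0 -compA ew e1.
by rewrite -!compA ew e2 compA factor_mapP.
Qed.

Lemma frac_at2 M N X (s : hom X M) (u v : hom X N) a b : Ciso C s ->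
  fracof s u a -> fracof s v b ->
  exists (i : cosubobject C M) (n : insubobject C N) (f g : hom i (factor_ob n)) (m : hom X i),
    [/\ epi m, so_mor i ∘ m = s, f ∘ m = factor_pr n ∘ u, g ∘ m = factor_pr n ∘ v
      & a = qclass f /\ b = qclass g].
Proof.
move=> ws [i1 [n1 [f1 [m1 [-> e1 e1']]]]] [i2 [n2 [f2 [m2 [-> e2 e2']]]]].
have [i [m [hm e]]] := Ciso_image ws; have [n [h1 h2]] := insub_directed n1 n2.
have [f -> ef] := frac_at hm e e1 e1' h1; have [g -> eg] := frac_at hm e e2 e2' h2.
by exists i, n, f, g, m.
Qed.

Lemma frac_uniq M N X (s : hom X M) (u : hom X N) a b : Ciso C s ->
  fracof s u a -> fracof s u b -> a = b.
Proof.
move=> ws h1 h2; have [i [n [f [g [m [hm _ e1 e2 [-> ->]]]]]]] := frac_at2 ws h1 h2.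
by congr qclass; apply: hm; rewrite e1 e2.
Qed.

Lemma frac_add M N X (s : hom X M) (u v : hom X N) a b : Ciso C s ->
  fracof s u a -> fracof s v b -> fracof s (u + v) (a + b).
Proof.
move=> ws h1 h2; have [i [n [f [g [m [hm e e1 e2 [-> ->]]]]]]] := frac_at2 ws h1 h2.
by exists i, n, (f + g), m; rewrite qclassD compDm e1 e2 compmD.
Qed.

Lemma frac_opp M N X (s : hom X M) (u : hom X N) a : Ciso C s ->
  fracof s u a -> fracof s (- u) (- a).
Proof.
move=> ws h; have [b hb] := frac_build (- u) ws.
have z1 := frac_add ws h hb; have z2 := frac_add ws z1 z1.
rewrite !subrr addr0 in z1 z2; have /eqP := frac_uniq ws z1 z2.
rewrite -{1}(addr0 (a + b)) => /eqP/addrI/esym/eqP; rewrite addrC addr_eq0 => /eqP <- //.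
Qed.

Lemma frac_zero M N X (s : hom X M) (u : hom X N) : Ciso C s -> fracof s u 0 ->
  exists Y (c : hom Y X), Ciso C c /\ u ∘ c = 0.
Proof.
move=> ws [i [n [f [m [/esym/qclass0[i' [n' [h [h' e0]]]] e1 e2]]]]].
have [P [q [p hP]]] := pullback_ex (so_mor i') s.
have wp := Ciso_pullback hP (cosub_Ciso i').
have z : factor_pr n' ∘ (u ∘ p) = 0.
  have em : m ∘ p = sub_incl h ∘ q.
    by apply: (so_mono i); rewrite !compA e1 sub_inclP (proj1 hP).
  by rewrite -(factor_mapP h') -compA (compA _ u) -e2 -compA em !compA e0 comp0m.
have [v ev] := kernel_lift (mono_kernel (so_mono n') (cokerP _)) z.
exists _, (p ∘ ker v); split.
  exact: Ciso_comp (kernel_Ciso (nsP n') (kerP v)) wp.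
by rewrite compA -ev -compA ker0 compm0.
Qed.

(* b = v t^-1 = v2 t2^-1 *)
Lemma frac_key N P Y Y2 T (t : hom Y N) (v : hom Y P) (t2 : hom Y2 N) (v2 : hom Y2 P) b
    (x : hom T Y) (x2 : hom T Y2) :
  Ciso C t -> Ciso C t2 -> fracof t v b -> fracof t2 v2 b -> t ∘ x = t2 ∘ x2 ->
  exists T' (c : hom T' T), Ciso C c /\ v ∘ x ∘ c = v2 ∘ x2 ∘ c.
Proof.
move=> wt wt2 h h2 e; have [R [p [q hR]]] := pullback_ex t t2.
have [w [<- <-]] := pullback_lift hR e.
have wp : Ciso C (t ∘ p).
  by apply: Ciso_comp wt; apply: Ciso_pullback (pullback_sym hR) wt2.
have h2' := frac_comp q h2; rewrite -(proj1 hR) in h2'.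
have z := frac_add wp (frac_comp p h) (frac_opp wp h2').
rewrite subrr in z; have [U [c' [wc' ec']]] := frac_zero wp z.
have [T' [w' [c hT]]] := pullback_ex c' w.
exists T', c; split; first exact: Ciso_pullback hT wc'.
apply/eqP; rewrite -subr_eq0 -!compBm !compA -compBm -compA -(proj1 hT).
by rewrite compA ec' comp0m.
Qed.

(* (v t^-1) (u s^-1) = (v u') (s s')^-1 whenever u s' = t u' *)
Definition comp_of M N P (b : qhom N P) (a : qhom M N) (c : qhom M P) : Prop :=
  exists X Y Z (s : hom X M) (u : hom X N) (t : hom Y N) (v : hom Y P)
    (s' : hom Z X) (u' : hom Z Y),
  [/\ Ciso C s /\ fracof s u a, Ciso C t /\ fracof t v b, Ciso C s',
      u ∘ s' = t ∘ u' & fracof (s ∘ s') (v ∘ u') c].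

Lemma comp_of_ex M N P (b : qhom N P) (a : qhom M N) : exists c, comp_of b a c.
Proof.
have [X [s [u [ws ha]]]] := frac_ex a; have [Y [t [v [wt hb]]]] := frac_ex b.
have [Z [u' [s' hZ]]] := pullback_ex t u.
have ws' := Ciso_pullback hZ wt.
have [c hc] := frac_build (v ∘ u') (Ciso_comp ws' ws).
by exists c, X, Y, Z, s, u, t, v, s', u'; split=> //; rewrite (proj1 hZ).
Qed.

Lemma comp_of_uniq M N P (b : qhom N P) (a : qhom M N) c c2 :
  comp_of b a c -> comp_of b a c2 -> c = c2.
Proof.
move=> [X [Y [Z [s [u [t [v [s' [u' [[ws ha] [wt hb] ws' e hc]]]]]]]]]].
move=> [X2 [Y2 [Z2 [s2 [u2 [t2 [v2 [s2' [u2' [[ws2 ha2] [wt2 hb2] ws2' e2 hc2]]]]]]]]]].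
have wz := Ciso_comp ws' ws; have wz2 := Ciso_comp ws2' ws2.
have [T [z [z2 hT]]] := pullback_ex (s ∘ s') (s2 ∘ s2').
have w1 : Ciso C (s ∘ s' ∘ z).
  by apply: Ciso_comp wz; apply: Ciso_pullback (pullback_sym hT) wz2.
have [|T1 [d [wd ed]]] := frac_key (x := s' ∘ z) (x2 := s2' ∘ z2) ws ws2 ha ha2.
  by rewrite !compA (proj1 hT).
have [|T2 [g [wg eg]]] := frac_key (x := u' ∘ z ∘ d) (x2 := u2' ∘ z2 ∘ d) wt wt2 hb hb2.
  by rewrite !compA -e -e2; move: ed; rewrite !compA.
have E : v ∘ u' ∘ z ∘ d ∘ g = v2 ∘ u2' ∘ z2 ∘ d ∘ g by move: eg; rewrite !compA.
have h1 : fracof (s ∘ s' ∘ z ∘ d ∘ g) (v ∘ u' ∘ z ∘ d ∘ g) c.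
  by have := frac_comp (z ∘ d ∘ g) hc; rewrite !compA.
apply: (frac_uniq (Ciso_comp wg (Ciso_comp wd w1)) h1).
rewrite E (proj1 hT).
by have := frac_comp (z2 ∘ d ∘ g) hc2; rewrite !compA.
Qed.

Definition qcomp M N P (b : qhom N P) (a : qhom M N) : qhom M P :=
  projT1 (cid (comp_of_ex b a)).

Lemma qcompE M N P (b : qhom N P) (a : qhom M N) c : comp_of b a c -> qcomp b a = c.
Proof. by rewrite /qcomp; case: (cid _) => c' /= h /(comp_of_uniq h). Qed.

(* the class of f in Hom_A(M, N/0) *)
Definition Qmor M N (f : hom M N) : qhom M N :=
  @qclass M N (cosub_top M) (insub_bot N) (factor_pr (insub_bot N) ∘ f).

Lemma fracQ M N (f : hom M N) : fracof (idm M) f (Qmor f).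
Proof. by exists (cosub_top M), (insub_bot N), (factor_pr (insub_bot N) ∘ f), (idm M); rewrite comp1m compm1. Qed.

Lemma qcomp1m M N (a : qhom M N) : qcomp (Qmor (idm N)) a = a.
Proof.
apply: qcompE; have [X [s [u [ws ha]]]] := frac_ex a.
exists X, N, X, s, u, (idm N), (idm N), (idm X), u; split=> //.
- by split; [apply: Ciso_id | apply: fracQ].
- exact: Ciso_id.
- by rewrite compm1 comp1m.
- by rewrite compm1 comp1m.
Qed.

Lemma qcompm1 M N (a : qhom M N) : qcomp a (Qmor (idm M)) = a.
Proof.
apply: qcompE; have [X [s [u [ws ha]]]] := frac_ex a.
exists M, X, X, (idm M), (idm M), s, u, s, (idm X); split=> //.
- by split; [apply: Ciso_id | apply: fracQ].
- by rewrite compm1 comp1m.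
- by rewrite compm1 comp1m.
Qed.

Lemma frac_common M N (a b : qhom M N) : exists X (s : hom X M) (u v : hom X N),
  [/\ Ciso C s, fracof s u a & fracof s v b].
Proof.
have [X [s [u [ws ha]]]] := frac_ex a; have [Y [t [v [wt hb]]]] := frac_ex b.
have [P [p [q hP]]] := pullback_ex s t.
have hb' := frac_comp q hb; rewrite -(proj1 hP) in hb'.
exists P, (s ∘ p), (u ∘ p), (v ∘ q); split=> //; last exact: frac_comp.
by apply: Ciso_comp ws; apply: Ciso_pullback (pullback_sym hP) wt.
Qed.

Lemma qcompA M N P R (c : qhom P R) (b : qhom N P) (a : qhom M N) :
  qcomp c (qcomp b a) = qcomp (qcomp c b) a.
Proof.
have [X [s [u [ws ha]]]] := frac_ex a; have [Y [t [v [wt hb]]]] := frac_ex b.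
have [W [r [w [wr hc]]]] := frac_ex c.
have [Z [u' [s' hZ]]] := pullback_ex t u; have ws' := Ciso_pullback hZ wt.
have [V [v' [t' hV]]] := pullback_ex r v; have wt' := Ciso_pullback hV wr.
have [T [y [x hT]]] := pullback_ex t' u'; have wx := Ciso_pullback hT wt'.
have [ba hba] := frac_build (v ∘ u') (Ciso_comp ws' ws).
have [cb hcb] := frac_build (w ∘ v') (Ciso_comp wt' wt).
have [d hd] := frac_build (w ∘ v' ∘ y) (Ciso_comp wx (Ciso_comp ws' ws)).
have -> : qcomp b a = ba.
  by apply: qcompE; exists X, Y, Z, s, u, t, v, s', u'; split=> //; rewrite (proj1 hZ).
have -> : qcomp c b = cb.
  by apply: qcompE; exists Y, W, V, t, v, r, w, t', v'; split=> //; rewrite (proj1 hV).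
transitivity d; last symmetry; apply: qcompE.
- exists Z, W, T, (s ∘ s'), (v ∘ u'), r, w, x, (v' ∘ y); split=> //.
  + by split=> //; apply: Ciso_comp.
  + by rewrite -compA -(proj1 hT) !compA (proj1 hV).
  + by rewrite !compA.
- exists X, V, T, s, u, (t ∘ t'), (w ∘ v'), (s' ∘ x), y; split=> //.
  + by split=> //; apply: Ciso_comp.
  + exact: Ciso_comp.
  + by rewrite -compA (proj1 hT) !compA -(proj1 hZ).
  + by rewrite !compA.
Qed.

Lemma qcompDm M N P (b b' : qhom N P) (a : qhom M N) :
  qcomp (b + b') a = qcomp b a + qcomp b' a.
Proof.
have [X [s [u [ws ha]]]] := frac_ex a; have [Y [t [v [v' [wt hb hb']]]]] := frac_common b b'.
have [Z [u' [s' hZ]]] := pullback_ex t u; have ws' := Ciso_pullback hZ wt.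
have w := Ciso_comp ws' ws.
have [c hc] := frac_build (v ∘ u') w; have [c' hc'] := frac_build (v' ∘ u') w.
have -> : qcomp b a = c.
  by apply: qcompE; exists X, Y, Z, s, u, t, v, s', u'; split=> //; rewrite (proj1 hZ).
have -> : qcomp b' a = c'.
  by apply: qcompE; exists X, Y, Z, s, u, t, v', s', u'; split=> //; rewrite (proj1 hZ).
apply: qcompE; exists X, Y, Z, s, u, t, (v + v'), s', u'; split=> //.
- by split=> //; apply: frac_add.
- by rewrite (proj1 hZ).
- by rewrite compDm; apply: frac_add.
Qed.

Lemma qcompmD M N P (b : qhom N P) (a a' : qhom M N) :
  qcomp b (a + a') = qcomp b a + qcomp b a'.
Proof.
have [X [s [u [u' [ws ha ha']]]]] := frac_common a a'; have [Y [t [v [wt hb]]]] := frac_ex b.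
have [Z [w [s1 hZ]]] := pullback_ex t u; have w1 := Ciso_pullback hZ wt.
have [Z' [w' [s2 hZ']]] := pullback_ex t (u' ∘ s1); have w2 := Ciso_pullback hZ' wt.
pose s' := s1 ∘ s2; have ws' : Ciso C s' by apply: Ciso_comp.
have e : u ∘ s' = t ∘ (w ∘ s2) by rewrite !compA (proj1 hZ).
have e' : u' ∘ s' = t ∘ w' by rewrite compA -(proj1 hZ').
have [c hc] := frac_build (v ∘ (w ∘ s2)) (Ciso_comp ws' ws).
have [c' hc'] := frac_build (v ∘ w') (Ciso_comp ws' ws).
have -> : qcomp b a = c.
  by apply: qcompE; exists X, Y, Z', s, u, t, v, s', (w ∘ s2).
have -> : qcomp b a' = c'.
  by apply: qcompE; exists X, Y, Z', s, u', t, v, s', w'.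
apply: qcompE; exists X, Y, Z', s, (u + u'), t, v, s', (w ∘ s2 + w'); split=> //.
- by split=> //; apply: frac_add.
- by rewrite compDm e e' compmD.
- by rewrite compmD; apply: frac_add => //; apply: Ciso_comp.
Qed.

Definition serre_quotient_cat : preadditive :=
  @Preadditive (ob A) qhom (fun M => Qmor (idm M)) qcomp
    (fun _ _ _ _ c b a => qcompA c b a) qcomp1m qcompm1 qcompDm qcompmD.

Lemma Qmor_comp M N P (g : hom N P) (f : hom M N) : Qmor (g ∘ f) = qcomp (Qmor g) (Qmor f).
Proof.
symmetry; apply: qcompE; exists M, N, M, (idm M), f, (idm N), g, (idm M), f; split.
- by split; [apply: Ciso_id | apply: fracQ].
- by split; [apply: Ciso_id | apply: fracQ].
- exact: Ciso_id.
- by rewrite compm1 comp1m.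
- by rewrite compm1; apply: fracQ.
Qed.

Definition Qfun : functor A serre_quotient_cat :=
  @Functor A serre_quotient_cat (fun M => M) Qmor (fun M => erefl) (fun _ _ _ g f => Qmor_comp g f).

Notation Q := (fmor Qfun).

Lemma Q_additive : additive_functor Qfun.
Proof.
by move=> M N f g; apply: (frac_uniq (Ciso_id M) (fracQ _)); apply: frac_add (Ciso_id M) _ _; apply: fracQ.
Qed.

Implicit Types U V : serre_quotient_cat.

Lemma Q_frac (M N : A) (a : @hom serre_quotient_cat M N) :
  exists X (s : hom X M) (u : hom X N), Ciso C s /\ a ∘ Q s = Q u.
Proof.
have [X [s [u [ws ha]]]] := frac_ex a; exists X, s, u; split=> //.
apply: qcompE; exists X, X, X, (idm X), s, s, u, (idm X), (idm X); split=> //.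
- by split; [apply: Ciso_id | apply: fracQ].
- exact: Ciso_id.
- by rewrite !compm1; apply: fracQ.
Qed.

Lemma Q_iso (M N : A) (s : hom M N) : Ciso C s -> iso (Q s).
Proof.
move=> ws; have [t ht] := frac_build (idm M) ws.
exists (t : @hom serre_quotient_cat N M); split; apply: qcompE.
- exists M, M, M, (idm M), s, s, (idm M), (idm M), (idm M); split=> //.
  + by split; [apply: Ciso_id | apply: fracQ].
  + exact: Ciso_id.
  + by rewrite compm1; apply: fracQ.
- exists M, M, M, s, (idm M), (idm M), s, (idm M), (idm M); split=> //.
  + by split; [apply: Ciso_id | apply: fracQ].
  + exact: Ciso_id.
  + by rewrite compm1; have := frac_comp s (fracQ (idm N)); rewrite !comp1m.
Qed.

(* the class of f : M' -> N/N' is Q(N -> N/N')^-1 Q(f) Q(M' -> M)^-1 *)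
Lemma qclassE (M N : A) (i : cosubobject C M) (n : insubobject C N) (f : hom i (factor_ob n)) :
  Q (factor_pr n) ∘ (qclass f : @hom serre_quotient_cat M N) ∘ Q (so_mor i) = Q f.
Proof.
have [X [q [p hP]]] := pullback_ex (factor_pr n) f.
have wp := Ciso_pullback hP (insub_Ciso n).
have wip := Ciso_comp wp (cosub_Ciso i).
have ha : fracof (so_mor i ∘ p) q (qclass f) by exists i, n, f, p; rewrite (proj1 hP).
have e : (qclass f : @hom serre_quotient_cat M N) ∘ Q (so_mor i ∘ p) = Q q.
  apply: qcompE; exists X, X, X, (idm X), (so_mor i ∘ p), (so_mor i ∘ p), q, (idm X), (idm X).
  split=> //.
  - by split; [apply: Ciso_id | apply: fracQ].
  - exact: Ciso_id.
  - by rewrite !compm1; apply: fracQ.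
apply: (iso_epi (Q_iso wp)); rewrite -(compA _ (Q (so_mor i))) -fmor_comp -compA e.
by rewrite -!fmor_comp (proj1 hP).
Qed.

Lemma Q_zero (M N : A) (u : hom M N) : Q u = 0 ->
  exists X (c : hom X M), Ciso C c /\ u ∘ c = 0.
Proof.
by move=> e; apply: (frac_zero (Ciso_id M)); rewrite -[0]e; apply: fracQ.
Qed.

End SerreQuotient.

Section QuotientAbelian.
Variables (A : abelianCat) (C : thick A).
Implicit Types X Y Z M N : A.
Notation B := (serre_quotient_cat C).
Notation QF := (Qfun C).
Notation Q := (fmor (Qfun C)).

Let Q_add := @Q_additive A C.

Lemma Q_iso_cancel X Y (c : hom X Y) (Z : B) (a b : @hom B Y Z) :
  Ciso C c -> a ∘ Q c = b ∘ Q c -> a = b.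
Proof. by move=> /Q_iso/iso_epi h; apply: h. Qed.

Lemma Q_cofrac M N (a : @hom B M N) :
  exists Y (t : hom N Y) (v : hom M Y), Ciso C t /\ Q t ∘ a = Q v.
Proof.
have [X [s [u [ws e]]]] := Q_frac a; have [P [v [t hP]]] := pushout_ex s u.
exists P, t, v; split; first exact: Ciso_pushout hP ws.
by apply: (Q_iso_cancel ws); rewrite -compA e -!fmor_comp (proj1 hP).
Qed.

Lemma Q_zero_mem X : Q (idm X) = 0 <-> C X.
Proof.
split=> [/Q_zero[Y [c [wc]]]|hX].
  rewrite comp1m => c0; rewrite c0 in wc.
  apply: (Ciso_coker wc (c := idm X)).
  apply: is_cokernelI; [by rewrite compm0 | exact: (@epi_id A X) |].
  by move=> W g _; exists g; rewrite compm1.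
have h : Ciso C (0 : hom X X).
  split; exists X, (idm X); split=> //.
  - apply: is_kernelI; [by rewrite comp0m | exact: (@mono_id A X) |].
    by move=> W g _; exists g; rewrite comp1m.
  - apply: is_cokernelI; [by rewrite compm0 | exact: (@epi_id A X) |].
    by move=> W g _; exists g; rewrite compm1.
by apply: (Q_iso_cancel h); rewrite -fmor_comp compm0 comp0m (fmor0 Q_add).
Qed.

Lemma Q_kernel K X Y (k : hom K X) (u : hom X Y) : is_kernel k u -> is_kernel (Q k) (Q u).
Proof.
move=> hk; have mk := proj1 (mono0 k) (kernel_mono hk); apply: is_kernelI.
- by rewrite -fmor_comp (proj1 hk) (fmor0 Q_add).
- apply/mono0 => W a; have [T [s [v [ws e]]]] := Q_frac a => h.
  have : Q (k ∘ v) = 0 by rewrite fmor_comp -e compA h comp0m.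
  move=> /Q_zero[T' [c [wc]]]; rewrite -compA => /mk e0.
  by apply: (Q_iso_cancel ws); apply: (Q_iso_cancel wc); rewrite e -fmor_comp e0 !comp0m (fmor0 Q_add).
- move=> W a; have [T [s [v [ws e]]]] := Q_frac a => h.
  have : Q (u ∘ v) = 0 by rewrite fmor_comp -e compA h comp0m.
  move=> /Q_zero[T' [c [wc]]]; rewrite -compA => /(kernel_lift hk)[w ew].
  have [y [y1 y2]] := Q_iso (Ciso_comp wc ws).
  exists (Q w ∘ y); apply: (Q_iso_cancel (Ciso_comp wc ws)).
  by rewrite -!compA y1 compm1 fmor_comp compA e -!fmor_comp ew.
Qed.

Lemma Q_zero_l M N (u : hom M N) : Q u = 0 ->
  exists X (d : hom N X), Ciso C d /\ d ∘ u = 0.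
Proof.
move=> /Q_zero[X [c [wc e]]].
have [w ew] := cokernel_desc (cokerP c) e.
exists _, (coker w); split; first exact: (cokernel_Ciso (Ciso_coker wc (cokerP c)) (cokerP w)).
by rewrite -ew compA coker0 comp0m.
Qed.

Lemma Q_iso_cancel_l X Y (c : hom X Y) (Z : B) (a b : @hom B Z X) :
  Ciso C c -> Q c ∘ a = Q c ∘ b -> a = b.
Proof. by move=> /Q_iso/iso_mono h; apply: h. Qed.

Lemma Q_cokernel X Y D (c : hom Y D) (u : hom X Y) : is_cokernel c u -> is_cokernel (Q c) (Q u).
Proof.
move=> hk; have mk := proj1 (epi0 c) (cokernel_epi hk); apply: is_cokernelI.
- by rewrite -fmor_comp (proj1 hk) (fmor0 Q_add).
- apply/epi0 => W a; have [T [s [v [ws e]]]] := Q_cofrac a => h.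
  have : Q (v ∘ c) = 0 by rewrite fmor_comp -e -compA h compm0.
  move=> /Q_zero_l[T' [d [wd]]]; rewrite compA => /mk e0.
  by apply: (Q_iso_cancel_l ws); apply: (Q_iso_cancel_l wd); rewrite e -fmor_comp e0 !compm0 (fmor0 Q_add).
- move=> W a; have [T [s [v [ws e]]]] := Q_cofrac a => h.
  have : Q (v ∘ u) = 0 by rewrite fmor_comp -e -compA h compm0.
  move=> /Q_zero_l[T' [d [wd]]]; rewrite compA => /(cokernel_desc hk)[w ew].
  have [y [y1 y2]] := Q_iso (Ciso_comp ws wd).
  exists (y ∘ Q w); apply: (Q_iso_cancel_l (Ciso_comp ws wd)).
  by rewrite !compA y2 comp1m fmor_comp -compA e -!fmor_comp ew.
Qed.

Lemma Q_exact : exact_functor QF.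
Proof.
split=> [|N G M i p [h1 h2]]; first exact: Q_additive.
by split; [apply: Q_kernel | apply: Q_cokernel].
Qed.

Lemma serre_quotient_abelian : abelian B.
Proof.
split.
- have [Z [h _]] := zeroP A; exists (Z : B); apply/zero_obE.
  by rewrite -[LHS]/(Q (idm Z)) (h _ (idm Z) 0) (fmor0 Q_add).
- move=> X1 X2; have [P [i1 [i2 [p1 [p2 [a b c d e]]]]]] := ab_biproduct (abelianCatP A) X1 X2.
  exists (P : B), (Q i1), (Q i2), (Q p1), (Q p2).
  have z X Y : Q (0 : hom X Y) = 0 := fmor0 Q_add X Y.
  split.
  + exact: etrans (esym (fmor_comp QF p1 i1)) (congr1 Q a).
  + exact: etrans (esym (fmor_comp QF p2 i2)) (congr1 Q b).
  + exact: etrans (esym (fmor_comp QF p1 i2)) (etrans (congr1 Q c) (z _ _)).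
  + exact: etrans (esym (fmor_comp QF p2 i1)) (etrans (congr1 Q d) (z _ _)).
  + rewrite -[RHS]/(Q (idm P)) -e Q_add.
    by rewrite (fmor_comp QF i1 p1) (fmor_comp QF i2 p2).
- move=> X Y f; have [T [s [u [ws e]]]] := Q_frac f.
  exists (ker_ob u : B), (Q s ∘ Q (ker u)).
  have hk := Q_kernel (kerP u); rewrite -e in hk; have [y [y1 y2]] := Q_iso ws.
  apply: is_kernelI.
  + by rewrite compA (proj1 hk).
  + exact: mono_comp (iso_mono (Q_iso ws)) (kernel_mono hk).
  + move=> W g g0; have [|h eh] := kernel_lift (g := y ∘ g) hk.
      by rewrite compA -(compA f) y2 compm1.
    by exists h; rewrite -compA eh compA y2 comp1m.
- move=> X Y f; have [T [s [u [ws e]]]] := Q_frac f.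
  exists (coker_ob u : B), (Q (coker u)).
  by apply/(cokernel_epir _ _ (iso_epi (Q_iso ws))); rewrite e; apply: Q_cokernel (cokerP u).
- move=> X Y f hf; have [T [s [u [ws e]]]] := Q_frac f.
  have hu : mono (Q u) by rewrite -e; apply: mono_comp hf (iso_mono (Q_iso ws)).
  have [I [m [d [hm hd eu]]]] := image u.
  have hkd : is_kernel (ker u) d by apply/(kernel_monol _ _ hm); rewrite -eu; apply: kerP.
  have hK : C (ker_ob u).
    apply/Q_zero_mem; have hQk := kernel_mono (Q_kernel (kerP u)).
    have z : Q (ker u) = 0.
      by apply: hu; rewrite -fmor_comp ker0 (fmor0 Q_add) compm0.
    by apply: hQk; rewrite z !comp0m.
  have wd := Ciso_epi hd hkd hK; have [y [y1 y2]] := Q_iso ws.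
  exists (coker_ob m : B), (Q (coker m)).
  have hQm : is_kernel (Q m) (Q (coker m)) := Q_kernel (mono_kernel hm (cokerP m)).
  have -> : f = Q m ∘ (Q d ∘ y).
    by rewrite compA -fmor_comp -eu -e -compA y2 compm1.
  apply: kernel_isor hQm _; apply: iso_comp (Q_iso wd) _.
  by exists (Q s).
- move=> X Y f hf; have [T [t [v [wt e]]]] := Q_cofrac f.
  have hv : epi (Q v) by rewrite -e; apply: epi_comp (iso_epi (Q_iso wt)) hf.
  have [I [m [d [hm hd ev]]]] := image v.
  have hcm : is_cokernel (coker v) m by apply/(cokernel_epir _ _ hd); rewrite -ev; apply: cokerP.
  have hK : C (coker_ob v).
    apply/Q_zero_mem; have hQc := cokernel_epi (Q_cokernel (cokerP v)).
    have z : Q (coker v) = 0.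
      by apply: hv; rewrite -fmor_comp coker0 (fmor0 Q_add) comp0m.
    by apply: hQc; rewrite z !compm0.
  have wm := Ciso_mono hm hcm hK; have [y [y1 y2]] := Q_iso wt.
  exists (ker_ob d : B), (Q (ker d)).
  have hQd : is_cokernel (Q d) (Q (ker d)) := Q_cokernel (epi_cokernel hd (kerP d)).
  have -> : f = (y ∘ Q m) ∘ Q d.
    by rewrite -compA -fmor_comp -ev -e compA y1 comp1m.
  apply: cokernel_isol hQd _; apply: iso_comp _ (Q_iso wm).
  by exists (Q t).
Qed.

Definition serre_quotient : abelianCat := AbelianCat serre_quotient_abelian.

Lemma Q_iso_Ciso X Y (f : hom X Y) : iso (Q f) -> Ciso C f.
Proof.
move=> hf; split.
- exists _, (ker f); split; first exact: kerP.
  apply/Q_zero_mem; have hk := Q_kernel (kerP f); apply: (kernel_mono hk).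
  have z : Q (ker f) = 0 by apply: (iso_mono hf); rewrite (proj1 hk) compm0.
  by rewrite z !comp0m.
- exists _, (coker f); split; first exact: cokerP.
  apply/Q_zero_mem; have hk := Q_cokernel (cokerP f); apply: (cokernel_epi hk).
  have z : Q (coker f) = 0 by apply: (iso_epi hf); rewrite (proj1 hk) comp0m.
  by rewrite z !compm0.
Qed.

Definition torsion_free M : Prop :=
  forall X (f : hom X M), mono f -> C X -> zero_ob X.

Definition saturated M : Prop :=
  torsion_free M /\
  forall E D (i : hom M E) (p : hom E D), short_exact i p -> C D ->
    exists r : hom E M, r ∘ i = idm M.

Definition local M : Prop := forall X Y (s : hom X Y), Ciso C s ->
  forall f : hom X M, exists! g : hom Y M, g ∘ s = f.

Lemma local_ext M X Y (s : hom X Y) (f : hom X M) : local M -> Ciso C s ->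
  exists g : hom Y M, g ∘ s = f.
Proof. by move=> h ws; have [g [e _]] := h _ _ _ ws f; exists g. Qed.

Lemma local_eq M X Y (s : hom X Y) (f g : hom Y M) : local M -> Ciso C s ->
  f ∘ s = g ∘ s -> f = g.
Proof.
move=> h ws e; have [w [_ u]] := h _ _ _ ws (f ∘ s).
exact: etrans (esym (u f erefl)) (u g (esym e)).
Qed.

Lemma torsion_free0 M X (f : hom X M) : torsion_free M -> C X -> f = 0.
Proof.
move=> hM hX; have [I [m [e [hm he ->]]]] := image f.
have [h _] := hM _ _ hm (th_factor he hX).
by rewrite (h _ m 0) comp0m.
Qed.

Lemma saturatedP M : saturated M <-> local M.
Proof.
split=> [[tf sp] X Y s ws f|h].
- have uniq (g g' : hom Y M) : g ∘ s = g' ∘ s -> g = g'.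
    move=> e; apply/eqP; rewrite -subr_eq0; apply/eqP.
    have [|w <-] := cokernel_desc (g := g - g') (cokerP s); first by rewrite compBm e subrr.
    by rewrite (torsion_free0 w tf (Ciso_coker ws (cokerP s))) comp0m.
  suff [g eg] : exists g : hom Y M, g ∘ s = f.
    by exists g; split=> // g' e; apply: uniq; rewrite eg e.
  have [I [m [e [hm he es]]]] := image s; rewrite es in ws *.
  have hc : is_cokernel (coker (m ∘ e)) m by apply/(cokernel_epir _ _ he); apply: cokerP.
  have hk : is_kernel (ker (m ∘ e)) e by apply/(kernel_monol _ _ hm); apply: kerP.
  have [|f' ef] := cokernel_desc (g := f) (epi_cokernel he hk).
    exact: torsion_free0 tf (Ciso_ker ws (kerP _)).
  have [P [p [q hP]]] := pushout_ex m f'.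
  have [c' hc' _] := pushout_cokernel hP hc.
  have [r er] := sp _ _ _ _ (mono_ses (pushout_mono hP hm) hc') (Ciso_coker ws (cokerP _)).
  by exists (r ∘ p); rewrite -!compA (compA p) (proj1 hP) !compA er comp1m ef.
- split.
  + move=> X f hf hX; apply/zero_obE; apply: hf; rewrite compm0.
    have [Z hZ] := zeroP A.
    have w0 : Ciso C (0 : hom X Z).
      split.
      * exists X, (idm X); split=> //.
        apply: is_kernelI; [by rewrite comp0m | exact: (@mono_id A X) |].
        by move=> W g _; exists g; rewrite comp1m.
      * exists Z, (idm Z); split; last exact: th_zero.
        apply: is_cokernelI; [by rewrite compm0 | exact: (@epi_id A Z) |].
        by move=> W g _; exists g; rewrite compm1.
    by have [g] := local_ext f h w0; rewrite compm0 compm1 => <-.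
  + move=> E D i p [h1 h2] hD; apply: local_ext h _.
    exact: Ciso_mono (kernel_mono h1) h2 hD.
Qed.

Lemma local_kernel K X Y (k : hom K X) (f : hom X Y) :
  is_kernel k f -> local X -> local Y -> local K.
Proof.
move=> hk hX hY U V s ws g.
have [g' eg] := local_ext (k ∘ g) hX ws.
have [|h eh] := kernel_lift (g := g') hk.
  by apply: (local_eq hY ws); rewrite -compA eg compA (proj1 hk) !comp0m.
have mk := kernel_mono hk.
exists h; split=> [|h' eh']; first by apply: mk; rewrite compA eh.
by apply: mk; rewrite eh; apply: (local_eq hX ws); rewrite eg -compA eh'.
Qed.

Definition sat_cat : preadditive :=
  @Preadditive {X : A | saturated X} (fun U V => hom (sval U) (sval V))
    (fun U => idm (sval U)) (fun U V W g f => g ∘ f)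
    (fun _ _ _ _ h g f => compA h g f) (fun _ _ f => comp1m f) (fun _ _ f => compm1 f)
    (fun _ _ _ g g' f => compDm g g' f) (fun _ _ _ g f f' => compmD g f f').

Definition sat_incl : functor sat_cat A :=
  @Functor sat_cat A (fun U => sval U) (fun _ _ f => f) (fun _ => erefl) (fun _ _ _ _ _ => erefl).

End QuotientAbelian.

(* a localizing subcategory, with a chosen right adjoint of the quotient functor *)
Record localizing (A : abelianCat) := Localizing {
  loc_thick :> thick A;
  loc_adj : right_adjoint (Qfun loc_thick)
}.

Section Localizing.
Variables (A : abelianCat) (C : localizing A).
Implicit Types X Y Z M N : A.
Notation B := (serre_quotient C).
Notation Q := (fmor (Qfun C)).
Notation S := (loc_adj C).
Notation eta := (unit_ (loc_adj C)).
Notation eps := (counit_ (loc_adj C)).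

Let Q_add := @Q_additive A C.
Let S_add := radj_additive S Q_add.

Lemma S_local (Y : B) : local C (S Y).
Proof.
move=> U V s ws f; have [t [t1 t2]] := Q_iso ws.
have e : adj_l f ∘ t ∘ Q s = adj_l f by rewrite -compA t1 compm1.
exists (adj_r S (X := V) (adj_l f ∘ t)); split.
  by rewrite -adj_r_comp e adj_lK.
move=> g eg; apply: adj_l_inj; rewrite adj_rK -eg adj_l_comp -compA.
by rewrite t2 compm1.
Qed.

Lemma S_saturated (Y : B) : saturated C (S Y).
Proof. exact/saturatedP/S_local. Qed.

Lemma eps_mono (Y : B) : mono (eps Y).
Proof.
apply/mono0 => W a; have [X [s [u [ws e]]]] := Q_frac a => h.
apply: (Q_iso_cancel ws); rewrite e comp0m.
have -> : u = 0.
  apply: (adj_l_inj (S := S)); rewrite /adj_l -e compA h comp0m.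
  by rewrite (fmor0 Q_add) compm0.
by rewrite (fmor0 Q_add).
Qed.

Lemma Q_eta_iso X : iso (Q (eta X)).
Proof.
have e := counit_unit S X; exists (eps X); split=> //.
apply: (@eps_mono X); rewrite compA.
by rewrite (e : eps X ∘ Q (eta X) = _) comp1m compm1.
Qed.

Lemma eps_iso (Y : B) : iso (eps Y).
Proof.
have [t [t1 t2]] := Q_eta_iso Y; have e := counit_unit S Y.
by exists (Q (eta Y)); split=> //; apply: (@eps_mono Y); rewrite compA (e : eps Y ∘ Q (eta Y) = _) comp1m compm1.
Qed.

Lemma eta_Ciso X : Ciso C (eta X).
Proof. exact: Q_iso_Ciso (Q_eta_iso X). Qed.

(* corestriction of S o Q *)
Definition Qhat : functor A (sat_cat C) :=
  @Functor A (sat_cat C) (fun X => exist _ (S (Qfun C X)) (S_saturated (Qfun C X)))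
    (fun X Y f => fmor S (Q f))
    (fun X => etrans (congr1 (fmor S) (fmor_id (Qfun C) X)) (fmor_id S _))
    (fun X Y Z g f => etrans (congr1 (fmor S) (fmor_comp (Qfun C) g f)) (fmor_comp S _ _)).

Lemma sat_local (X : sat_cat C) : local C (sval X).
Proof. exact/saturatedP/(svalP X). Qed.
Arguments sat_local : clear implicits.

Lemma Qhat_nat X Y (f : hom X Y) : @comp A _ _ _ (fmor Qhat f) (eta X) = eta Y ∘ f.
Proof. by rewrite unit_nat. Qed.

Lemma eta_zero X : eta X = 0 -> C X.
Proof.
move=> e; apply/Q_zero_mem.
by apply: (iso_mono (Q_eta_iso X)); rewrite e (fmor0 Q_add) !comp0m.
Qed.

Lemma sat_kernel (K X Y : sat_cat C) (k : hom K X) (f : hom X Y) :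
  is_kernel k f -> @is_kernel A (sval K) (sval X) (sval Y) k f.
Proof.
move=> hk; have hkk : forall T (g : hom T (sval X)), @comp A _ _ _ f g = 0 ->
    exists h : hom T (sval K), @comp A _ _ _ k h = g.
  move=> T g g0; have [g' eg] := local_ext g (sat_local X) (eta_Ciso T).
  have [|h eh] := @kernel_lift _ K X Y k f (Qhat T) g' hk.
    apply: (local_eq (sat_local Y) (eta_Ciso T)).
    by rewrite -compA eg g0 comp0m.
  by exists (@comp A _ _ _ h (eta T)); rewrite compA; move: eh => /= ->.
apply: is_kernelI; [exact: (proj1 hk) | | exact: hkk].
apply/mono0 => T g g0; have [g' eg] := local_ext g (sat_local K) (eta_Ciso T).
have z : g' = 0.
  apply: (@kernel_mono _ K X Y k f hk (Qhat T)); rewrite compm0.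
  apply: (local_eq (sat_local X) (eta_Ciso T)).
  by rewrite -compA eg g0 comp0m.
by rewrite -eg z comp0m.
Qed.

Lemma kernel_sat (K X Y : sat_cat C) (k : hom K X) (f : hom X Y) :
  @is_kernel A (sval K) (sval X) (sval Y) k f -> is_kernel k f.
Proof. by move=> [e h]; split=> // W g; apply: (h (sval W)). Qed.

(* cokernels in Sat: apply Qhat to cokernels in A *)
Lemma sat_cokernel (X Y : sat_cat C) (f : hom X Y) D (c : hom (sval Y) D) :
  @is_cokernel A (sval X) (sval Y) D c f ->
  @is_cokernel (sat_cat C) X Y (Qhat D) (@comp A _ _ _ (eta D) c) f.
Proof.
move=> hc; apply: is_cokernelI.
- by rewrite /= -compA (proj1 hc) compm0.
- move=> W g h /=; rewrite !compA => /(cokernel_epi hc).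
  exact: (local_eq (sat_local W) (eta_Ciso D)).
- move=> W g /= g0; have [w ew] := cokernel_desc hc g0.
  have [w' ew'] := local_ext w (sat_local W) (eta_Ciso D).
  by exists w'; rewrite /= compA ew' ew.
Qed.

Lemma sat_abelian : abelian (sat_cat C).
Proof.
split.
- have [Z [h1 h2]] := zeroP A; have hZ : saturated C Z.
    split=> [X f hf _|E D i p _ _]; last by exists 0; apply: h1.
    by apply/zero_obE; apply: hf; apply: h2.
  by exists (exist _ Z hZ); split=> X f g; [apply: h1 | apply: h2].
- move=> X1 X2; have [P [i1 [i2 [p1 [p2 h]]]]] := ab_biproduct (abelianCatP A) (sval X1) (sval X2).
  have hP : saturated C P.
    have [e11 e22 e12 e21 e] := h.
    apply/saturatedP => U V s ws f.
    have [g1 h1] := local_ext (p1 ∘ f) (sat_local X1) ws.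
    have [g2 h2] := local_ext (p2 ∘ f) (sat_local X2) ws.
    exists (i1 ∘ g1 + i2 ∘ g2); split.
      by rewrite compDm -!compA h1 h2 !compA -compDm e comp1m.
    move=> g' eg; apply: (biproduct_eq h).
    + apply: (local_eq (sat_local X1) ws).
      by rewrite -[RHS]compA eg compmD !compA e11 e12 comp1m comp0m addr0.
    + apply: (local_eq (sat_local X2) ws).
      by rewrite -[RHS]compA eg compmD !compA e22 e21 comp1m comp0m add0r.
  by exists (exist _ P hP), i1, i2, p1, p2; case: h.
- move=> X Y f; have hk := @kerP A (sval X) (sval Y) f.
  have hK : saturated C (@ker_ob A _ _ f).
    by apply/saturatedP; apply: local_kernel hk (sat_local X) (sat_local Y).
  by exists (exist _ _ hK), (@ker A (sval X) (sval Y) f); apply: kernel_sat.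
- move=> X Y f.
  by exists (Qhat (@coker_ob A (sval X) (sval Y) f)), (@comp A _ _ _ (eta _) (@coker A (sval X) (sval Y) f)); apply: sat_cokernel (cokerP _).
- move=> X Y f hf; pose c := @coker A (sval X) (sval Y) f.
  have hk := @kerP A (sval X) (sval Y) f.
  have hK : saturated C (@ker_ob A _ _ f).
    by apply/saturatedP; apply: local_kernel hk (sat_local X) (sat_local Y).
  have z : @ker A (sval X) (sval Y) f = 0.
    apply: (hf (exist _ _ hK) (@ker A (sval X) (sval Y) f) 0).
    by rewrite compm0; exact: (proj1 hk).
  have mf : @mono A (sval X) (sval Y) f.
    apply/mono0 => T g /(kernel_lift hk)[w <-]; by rewrite z comp0m.
  have kf := mono_kernel mf (cokerP _).
  exists (Qhat (coker_ob (f : @hom A (sval X) (sval Y)))), (@comp A _ _ _ (eta _) c).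
  apply: is_kernelI => //.
    by rewrite /= -compA coker0 compm0.
  move=> W g /= g0.
  have [v ev] := kernel_lift (kerP (eta (coker_ob (f : @hom A (sval X) (sval Y))))) (etrans (compA _ _ _) g0).
  have hker : C (ker_ob (eta (coker_ob (f : @hom A (sval X) (sval Y))))) := Ciso_ker (eta_Ciso _) (kerP _).
  have wk := kernel_Ciso hker (kerP v).
  have [|h eh] := kernel_lift (g := @comp A _ _ _ g (ker v)) kf.
    by rewrite compA -ev -compA ker0 compm0.
  have [h' eh'] := local_ext h (sat_local X) wk.
  exists h'; apply: (local_eq (sat_local Y) wk).
  by rewrite -eh -eh' compA.
- move=> X Y f hf; have hk := @kerP A (sval X) (sval Y) f.
  have hK : saturated C (@ker_ob A _ _ f).
    by apply/saturatedP; apply: local_kernel hk (sat_local X) (sat_local Y).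
  exists (exist _ _ hK), (@ker A (sval X) (sval Y) f).
  have [I [m [e [hm he ef]]]] := @image A (sval X) (sval Y) f.
  apply: is_cokernelI => //; first exact: (proj1 hk).
  move=> W g /= g0.
  have hke : is_kernel (@ker A (sval X) (sval Y) f) e.
    by apply/(kernel_monol _ _ hm); rewrite -ef.
  have [g' eg'] := cokernel_desc (epi_cokernel he hke) g0.
  have hcm : @is_cokernel A _ _ _ (coker m) f.
    by rewrite ef; apply/(cokernel_epir _ _ he); apply: cokerP.
  have z : eta (coker_ob m) = 0.
    have /cokernel_epi ep := cokerP m; apply: ep; rewrite comp0m.
    have [h0 _] := sat_cokernel hcm.
    by apply: (hf (Qhat (coker_ob m)) (@comp A _ _ _ (eta _) (coker m)) 0); rewrite comp0m.
  have wm := Ciso_mono hm (cokerP m) (eta_zero z).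
  have [g'' eg''] := local_ext g' (sat_local W) wm.
  by exists g''; rewrite /= ef compA eg'' eg'.
Qed.

Definition Sat : abelianCat := AbelianCat sat_abelian.

Lemma Qhat_additive : additive_functor Qhat.
Proof. move=> X Y f g; exact: etrans (congr1 (fmor S) (Q_add f g)) (S_add _ _). Qed.

Lemma Qhat_exact : @exact_functor A Sat Qhat.
Proof.
split=> [|N G M i p [h1 h2]]; first exact: Qhat_additive.
have z : fmor Qhat p ∘ fmor Qhat i = 0.
  exact: etrans (esym (fmor_comp Qhat p i))
    (etrans (congr1 (fmor Qhat) (proj1 h1)) (fmor0 Qhat_additive _ _)).
have kQ := Q_kernel C h1; split.
- apply: (kernel_sat (K := Qhat N) (X := Qhat G) (Y := Qhat M)); apply: is_kernelI.
  + exact: z.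
  + apply/mono0 => W g g0; apply: adj_l_inj; apply: (kernel_mono kQ).
    by rewrite -!adj_l_compl compm0; congr adj_l.
  + move=> W g g0; have [|h eh] := kernel_lift (g := adj_l g) kQ.
      by rewrite -adj_l_compl (g0 : @comp A _ _ _ (fmor S (Q p)) g = 0) /adj_l (fmor0 Q_add) compm0.
    by exists (adj_r S h); rewrite -adj_r_compl eh adj_lK.
- apply: is_cokernelI.
  + exact: z.
  + move=> W g h /= e; apply: (local_eq (sat_local W) (eta_Ciso M)).
    apply: (cokernel_epi h2); rewrite -!compA !unit_nat !compA.
    by rewrite e.
  + move=> W g /= g0; have [|w ew] := cokernel_desc (g := @comp A _ _ _ g (eta G)) h2.
      by rewrite -compA unit_nat compA g0 comp0m.
    have [w' ew'] := local_ext w (sat_local W) (eta_Ciso M).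
    exists w'; apply: (local_eq (sat_local W) (eta_Ciso G)).
    by rewrite /= -compA -unit_nat compA ew' ew.
Qed.

(* the restriction of Q to Sat *)
Definition sat_Q : functor Sat B := @fcomp Sat A B (Qfun C) (sat_incl C).

Lemma sat_Q_exact : exact_functor sat_Q.
Proof.
split=> [X Y f g|N G M i p [h1 h2]]; first exact: Q_add.
have k1 := Q_kernel C (sat_kernel h1); split=> //.
apply: is_cokernelI; first exact: (proj1 k1).
- move=> W g h e; apply: (adj_r_inj (S := S)).
  apply: (@cokernel_epi Sat N G M p i h2 (exist _ (S W) (S_saturated W)) (adj_r S g) (adj_r S h)).
  by rewrite /= -!adj_r_comp; congr adj_r.
- move=> W g g0.
  have [|w ew] := @cokernel_desc Sat N G M p i (exist _ (S W) (S_saturated W)) (adj_r S g) h2.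
    by rewrite /= -adj_r_comp; rewrite (g0 : g ∘ Q i = 0) /adj_r (fmor0 S_add) comp0m.
  exists (adj_l (S := S) w); rewrite -(adj_rK S g) -ew.
  by rewrite adj_l_comp.
Qed.

End Localizing.

Definition iso_inv_mor (A : preadditive) (X Y : A) (f : hom X Y) (h : iso f) : hom Y X :=
  projT1 (cid h).

Lemma iso_inv_morK (A : preadditive) (X Y : A) (f : hom X Y) (h : iso f) :
  iso_inv_mor h ∘ f = idm X /\ f ∘ iso_inv_mor h = idm Y.
Proof. exact: (projT2 (cid h)). Qed.

Section ExtSystem.
Variables (A : abelianCat) (C : thick A) (M N : A).

(* Ext^1(M', N) over M' <= M with M/M' in C, ordered by reverse inclusion *)
Definition ext_system : directSystem.
Proof.
refine (@DirectSystem (cosubobject C M) (fun x y => sub_le y x) _ _ _ _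
  (fun x => Ext1 (so_ob x) N) (fun x y h => ext_pull (sub_incl h)) _ _).
- by move=> x; apply: sub_le_refl.
- by move=> x y z h h'; apply: sub_le_trans h' h.
- exact: cosub_directed.
- by exists (cosub_top C M).
- by move=> x h e; rewrite /= sub_incl_id ext_pull_id.
- by move=> x y z h h' h'' e; rewrite /= ext_pull_comp (sub_incl_comp _ _ h'').
Defined.

End ExtSystem.

Section QhatExt.
Variables (A : abelianCat) (C : localizing A) (M N : A).
Notation QhatM := (Qhat C M : Sat C).
Notation QhatN := (Qhat C N : Sat C).

Lemma Qhat_sub_iso (i : cosubobject C M) : iso (fmor (Qhat C) (so_mor i)).
Proof.
have [t [t1 t2]] := fmor_iso (loc_adj C) (Q_iso (cosub_Ciso i)).
by exists t; split.
Qed.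

(* Ext^1_A(M', N) -> Ext^1_Sat(Qhat M', Qhat N) = Ext^1_Sat(Qhat M, Qhat N) *)
Definition Qhat_ext_sub (i : cosubobject C M) :
    {additive Ext1 (so_ob i) N -> Ext1 QhatM QhatN} :=
  (ext_pull (iso_inv_mor (Qhat_sub_iso i) : @hom (Sat C) QhatM (Qhat C (so_ob i)))
     \o Ext1_map (Qhat_exact C) (M := so_ob i) (N := N)).

Lemma Qhat_ext_sub_compat (i j : cosubobject C M) (h : sub_le j i) (e : Ext1 (so_ob i) N) :
  Qhat_ext_sub j (ext_pull (sub_incl h) e) = Qhat_ext_sub i e.
Proof.
rewrite /= Ext1_map_pull ext_pull_comp; congr ext_pull.
have [a1 a2] := iso_inv_morK (Qhat_sub_iso i); have [b1 b2] := iso_inv_morK (Qhat_sub_iso j).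
apply: (iso_mono (Qhat_sub_iso i)); rewrite a2 compA.
apply: etrans (_ : fmor (Qhat C) (so_mor j) ∘ iso_inv_mor (Qhat_sub_iso j) = _) => //.
congr (_ ∘ _); apply: etrans (esym (fmor_comp (Qhat C) _ _)) _.
by rewrite sub_inclP.
Qed.

Definition Qhat_Ext :
    {additive dirlim (ext_system C M N) -> Ext1 QhatM QhatN} :=
  dl_desc (D := ext_system C M N) Qhat_ext_sub_compat.

(* the map induced by the equivalence Sat -> A/C, followed by the
   identifications of Q S Q M with Q M and of Q S Q N with Q N *)
Definition sat_Ext :
    {additive Ext1 QhatM QhatN ->
       Ext1 (Qfun C M : serre_quotient C) (Qfun C N : serre_quotient C)} :=
  (ext_push (counit_ (loc_adj C) (Qfun C N) :
       @hom (serre_quotient C) (sat_Q C QhatN) (Qfun C N))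
     \o (ext_pull (fmor (Qfun C) (unit_ (loc_adj C) M) :
            @hom (serre_quotient C) (Qfun C M) (sat_Q C QhatM))
     \o Ext1_map (A := Sat C) (B := serre_quotient C) (sat_Q_exact C) (M := QhatM) (N := QhatN))).

End QhatExt.

(* Main.v *)
From mathcomp Require Import all_boot ssralg.
From mathcomp Require Import boolp.
Require Import Defs.

(* An extension of saturated objects in Sat is left exact in A, and its
   projection has cokernel in C there; corestricting the projection to its
   image gives an extension in A of a subobject of M with cokernel in C, which
   is a preimage.  Conversely, since N is isomorphic to Qhat N, a retraction of
   Qhat(N) -> Qhat(G) restricts along the unit of G to a retraction of N -> G,
   so that Ext^1(M', N) -> Ext^1(Qhat M', Qhat N) is injective for each M'.
   The second map is bijective because Sat -> A/C is an exact equivalence. *)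

Set Implicit Arguments.
Unset Strict Implicit.
Unset Printing Implicit Defensive.

Import GRing.Theory.
Local Open Scope ring_scope.

Lemma inj_surj_bij (T U : Type) (f : T -> U) :
  injective f -> (forall y, exists x, f x = y) -> bijective f.
Proof.
move=> fI fS; pose g y := projT1 (cid (fS y)).
have fK : cancel g f by move=> y; apply: (projT2 (cid (fS y))).
by exists g => // x; apply: fI; rewrite fK.
Qed.

Section ExtSplit.
Variable A : abelianCat.
Implicit Types M N : A.

(** Zero is the class of the biproduct sequence, and [r] and [ext_pr E] are the two components of a
    chain morphism into it. Injectivity of maps on Ext thus reduces to transporting retractions. *)
Lemma ext_class_eq0 M N (E : ext M N) :
  ext_class E = 0 <-> exists r, r ∘ ext_in E = idm N.
Proof.
have [e11 e22 e12 e21 _] := bpP (bip N M).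
split=> [/ext_classE[b [h1 _]]|[r er]].
  by exists (bp_p1 (bip N M) ∘ b); rewrite -compA h1 compm1.
apply/ext_classE; exists (bp_i1 (bip N M) ∘ r + bp_i2 (bip N M) ∘ ext_pr E); split=> /=.
  by rewrite compDm -!compA er (proj1 (proj1 (ext_exact E))) compm0 addr0.
by rewrite compmD !compA e21 e22 comp0m comp1m add0r.
Qed.

Lemma ext_pull_bij M M' N (c : hom M' M) :
  iso c -> bijective (@ext_pull A M N M' c).
Proof.
by move=> [d [dc cd]]; exists (ext_pull d) => e;
  rewrite ext_pull_comp ?cd ?dc ext_pull_id.
Qed.

Lemma ext_push_bij M N N' (a : hom N N') :
  iso a -> bijective (@ext_push A M N N' a).
Proof.
by move=> [b [ba ab]]; exists (ext_push b) => e;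
  rewrite ext_push_comp ?ba ?ab ext_push_id.
Qed.

Lemma short_exact_iso (N G G' M : A) (i : hom N G) (p : hom G M) (u : hom G' G)
    (v : hom G G') :
  u ∘ v = idm G -> v ∘ u = idm G' -> short_exact i p -> short_exact (v ∘ i) (p ∘ u).
Proof.
move=> uv vu [ki cp].
have iu : iso u by exists v.
have iv : iso v by exists u.
split; [apply: is_kernelI | apply: is_cokernelI].
- by rewrite -compA (compA u) uv comp1m (proj1 ki).
- exact: mono_comp (iso_mono iv) (kernel_mono ki).
- move=> W g g0; have [|h eh] := kernel_lift (g := u ∘ g) ki; first by rewrite compA.
  by exists h; rewrite -compA eh compA vu comp1m.
- by rewrite -compA (compA u) uv comp1m (proj1 ki).
- exact: epi_comp (cokernel_epi cp) (iso_epi iu).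
- move=> W g g0; have [|h eh] := cokernel_desc (g := g ∘ v) cp; first by rewrite -compA.
  by exists h; rewrite compA eh -compA vu compm1.
Qed.

End ExtSplit.

Section ExactEquivalence.
Variables (A B : abelianCat) (F : functor A B) (exF : exact_functor F).
Hypothesis full : forall (X Y : A) (g : hom (F X) (F Y)), exists f, fmor F f = g.
Hypothesis faithful : forall (X Y : A) (f g : hom X Y), fmor F f = fmor F g -> f = g.
Hypothesis ess_surj : forall Y : B, exists X (u : hom (F X) Y), iso u.

(** The universal properties hold in particular against objects [F W]; fullness lifts the
    factorizations and faithfulness lifts the equations. *)
Lemma short_exact_reflect (N G M : A) (i : hom N G) (p : hom G M) :
  short_exact (fmor F i) (fmor F p) -> short_exact i p.
Proof.
have F0 := fmor0 (exact_additive exF).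
move=> [ki cp].
have pi0 : p ∘ i = 0 by apply: faithful; rewrite fmor_comp (proj1 ki) F0.
split; [apply: is_kernelI => // | apply: is_cokernelI => //].
- move=> W g h e; apply/faithful/(kernel_mono ki).
  by rewrite -!fmor_comp e.
- move=> W g g0; have [|h eh] := kernel_lift (g := fmor F g) ki.
    by rewrite -fmor_comp g0 F0.
  by have [h' eh'] := full h; exists h'; apply: faithful; rewrite fmor_comp eh'.
- move=> W g h e; apply/faithful/(cokernel_epi cp).
  by rewrite -!fmor_comp e.
- move=> W g g0; have [|h eh] := cokernel_desc (g := fmor F g) cp.
    by rewrite -fmor_comp g0 F0.
  by have [h' eh'] := full h; exists h'; apply: faithful; rewrite fmor_comp eh'.
Qed.

Lemma Ext1_map_bij (M N : A) : bijective (@Ext1_map A B F exF M N).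
Proof.
apply: inj_surj_bij.
  apply/(raddf_inj (f := Ext1_map exF (M := M) (N := N))) => e.
  have [E ->] := ext_surj e; rewrite /= Ext1_mapE => /ext_class_eq0[r er].
  have [r' er'] := full r; apply/ext_class_eq0; exists r'.
  by apply: faithful; rewrite fmor_comp er' er fmor_id.
move=> e; have [E ->] := ext_surj e.
(* Surjectivity: replace the middle term by an isomorphic [F G], then lift both maps by fullness. *)
have [G [u [v [vu uv]]]] := ess_surj (ext_mid E).
have [i ei] := full (v ∘ ext_in E); have [p ep] := full (ext_pr E ∘ u).
have hE : short_exact i p.
  apply: short_exact_reflect; rewrite ei ep.
  exact: short_exact_iso uv vu (ext_exact E).
exists (ext_class (Extension hE)); rewrite Ext1_mapE; apply/ext_classE.
exists u; split=> /=; first by rewrite ei compA uv comp1m compm1.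
by rewrite ep comp1m.
Qed.

End ExactEquivalence.

Section SaturatedExt.
Variables (A : abelianCat) (C : localizing A).
Implicit Types M N X Y : A.
Notation B := (serre_quotient C).
Notation Q := (fmor (Qfun C)).
Notation S := (loc_adj C).
Notation eta := (unit_ (loc_adj C)).
Notation eps := (counit_ (loc_adj C)).

(** The inverse is the extension of [idm X] along [s]. *)
Lemma local_Ciso_iso X Y (s : hom X Y) : local C X -> local C Y -> Ciso C s -> iso s.
Proof.
move=> lX lY ws; have [t ts] := local_ext (idm X) lX ws.
by exists t; split=> //; apply: (local_eq lY ws); rewrite -compA ts compm1 comp1m.
Qed.

Lemma eta_iso X : saturated C X -> iso (eta X).
Proof. by move=> /saturatedP lX; apply: local_Ciso_iso lX (@S_local A C (Qfun C X)) (eta_Ciso C X). Qed.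

Lemma sat_Q_full (X Y : Sat C) (g : hom (sat_Q C X) (sat_Q C Y)) :
  exists f, fmor (sat_Q C) f = g.
Proof.
have [t [te et]] := eta_iso (svalP Y).
(* By the triangle identity [eps] is inverse to [Q (eta Y)], and so is [Q t]. *)
have Qt : Q t = eps (Qfun C (sval Y)).
  rewrite -[LHS]comp1m -(counit_unit S (sval Y)) -compA.
  by rewrite -[X in _ ∘ X](fmor_comp (Qfun C)) et fmor_id compm1.
exists (t ∘ adj_r S g); rewrite [LHS](fmor_comp (Qfun C)) Qt; exact: (adj_rK S g).
Qed.

(** Naturality of the unit recovers [eta Y ∘ f] from [Q f], and [eta Y] is mono. *)
Lemma sat_Q_faithful (X Y : Sat C) (f g : hom X Y) :
  fmor (sat_Q C) f = fmor (sat_Q C) g -> f = g.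
Proof.
move=> e; apply: (iso_mono (eta_iso (svalP Y))).
by rewrite !unit_nat; congr (fmor S _ ∘ _).
Qed.

Lemma sat_Q_ess_surj (Y : B) : exists (X : Sat C) (u : hom (sat_Q C X) Y), iso u.
Proof. by exists (exist _ (S Y) (S_saturated Y)), (eps Y); apply: eps_iso. Qed.

Lemma sat_Ext_bij M N : bijective (sat_Ext C M N).
Proof.
have h1 := @ext_push_bij B (Qfun C M) _ _ _ (@eps_iso A C (Qfun C N)).
have h2 := @ext_pull_bij B _ _ (sat_Q C (Qhat C N)) _ (Q_eta_iso C M).
have h3 := @Ext1_map_bij (Sat C) B _ (sat_Q_exact C) sat_Q_full sat_Q_faithful
  sat_Q_ess_surj (Qhat C M) (Qhat C N).
exact: bij_comp h1 (bij_comp h2 h3).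
Qed.

(** The cokernel of [p] in Sat is [eta ∘ c]. It vanishes for an epi, hence [eta] vanishes on the
    cokernel taken in [A]. *)
Lemma sat_epi_coker (X Y : Sat C) (p : hom X Y) :
  epi p -> C (@coker_ob A (sval X) (sval Y) p).
Proof.
move=> hp; apply: eta_zero; set c := @coker A (sval X) (sval Y) p.
have hc : is_cokernel c p := @cokerP A (sval X) (sval Y) p.
have [h0 _] := sat_cokernel hc.
apply: (cokernel_epi hc); rewrite comp0m.
by apply: (proj1 (epi0 (A := Sat C) p) hp (Qhat C _)).
Qed.

Lemma Ext1_map_Qhat_inj M N : saturated C N ->
  injective (Ext1_map (Qhat_exact C) (M := M) (N := N)).
Proof.
move=> satN; apply/(raddf_inj (f := Ext1_map (Qhat_exact C) (M := M) (N := N))) => e.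
have [E ->] := ext_surj e; rewrite /= Ext1_mapE => /ext_class_eq0[r er].
have [t [te _]] := eta_iso satN; apply/ext_class_eq0.
exists (t ∘ @comp A _ _ _ r (eta _)).
rewrite -!compA unit_nat (compA _ _ (eta N)).
rewrite (er : @comp A _ _ _ r (fmor S (Q (ext_in E))) = idm _).
by rewrite comp1m te.
Qed.

Lemma Qhat_Ext_in M N (i : cosubobject C M) (e : Ext1 (so_ob i) N) :
  Qhat_Ext C M N (@dl_in (ext_system C M N) i e) = Qhat_ext_sub N i e.
Proof. exact: (@dl_descE (ext_system C M N) _ _ (@Qhat_ext_sub_compat A C M N)). Qed.

(** Each class lives at some stage M', where the map is [Ext1_map] followed by pullback along an
    isomorphism; both are injective. *)
Lemma Qhat_Ext_inj M N : saturated C N -> injective (Qhat_Ext C M N).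
Proof.
move=> satN; apply/raddf_inj => a; have [i [e ->]] := dl_surj a.
rewrite -(dl_in0 i) => h; congr dl_in.
have {}h : Qhat_ext_sub N i e = 0.
  by rewrite -h -Qhat_Ext_in.
apply: (Ext1_map_Qhat_inj satN); apply/eqP; rewrite raddf0; apply/eqP.
have [w1 w2] := iso_inv_morK (Qhat_sub_iso i).
apply: (bij_inj (@ext_pull_bij (Sat C) _ _ (Qhat C N) (iso_inv_mor (Qhat_sub_iso i)) _)).
  by exists (fmor (Qhat C) (so_mor i)).
by rewrite raddf0.
Qed.

Lemma Qhat_Ext_surj M N : saturated C M -> saturated C N ->
  forall e, exists x, Qhat_Ext C M N x = e.
Proof.
move=> satM satN e; have [E ->] := ext_surj e; case: E => G i p [ki cp].
have [t [te et]] := eta_iso satM.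
have [I [m [q [mm hq pE]]]] := @image A (sval G) _ p.
have hc : is_cokernel (@coker A (sval G) _ p) m.
  by apply/(cokernel_epir _ _ hq); rewrite -pE; apply: cokerP.
have wm : Ciso C m := Ciso_mono mm hc (sat_epi_coker (cokernel_epi cp)).
have it : iso t by exists (eta M).
have wt : Ciso C t.
  by apply: Q_iso_Ciso; apply: fmor_iso.
(* The image of [p] lies in Qhat M; the inverse [t] of the unit carries it into M. *)
pose J : cosubobject C M := cosub_of (mono_comp (iso_mono it) mm) (Ciso_comp wm wt).
have kq : is_kernel (@comp A N _ (sval G) i (eta N)) q.
  apply: kernel_isor (eta_iso satN).
  by apply/(kernel_monol _ _ mm); rewrite -pE; exact: (sat_kernel ki).
pose F : ext (so_ob J) N := Extension (epi_ses hq kq).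
exists (@dl_in (ext_system C M N) J (ext_class F)).
rewrite Qhat_Ext_in /= Ext1_mapE.
have [w1 w2] := iso_inv_morK (Qhat_sub_iso J).
(* The unit of [G] is the chain morphism from the given extension to the image of [F] under Qhat. *)
apply: ext_pullE; exists (eta (sval G)); split => /=.
(* Maps from Qhat N to a local object are determined by their composites with [eta N]. *)
- apply: (local_eq (@S_local A C (Qfun C (sval G))) (@eta_Ciso A C N)).
  by rewrite compm1 -unit_nat compA.
(* After composition with the isomorphism from Qhat J to Qhat M, both sides become [p]. *)
- have eL : fmor S (Q (so_mor J)) ∘ (fmor S (Q q) ∘ eta (sval G)) = p.
    rewrite compA -!fmor_comp -unit_nat -[so_mor J]/(t ∘ m).
    by rewrite -(compA t) -pE compA et comp1m.
  have eR : fmor (Qhat C) (so_mor J) ∘ (iso_inv_mor (Qhat_sub_iso J) ∘ p) = p.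
    by rewrite compA w2 comp1m.
  by apply: (iso_mono (Qhat_sub_iso J)); apply: etrans eL (esym eR).
Qed.

End SaturatedExt.

Theorem theorem6p2 (A : abelianCat) (C : localizing A) (M N : A)
    (satM : saturated C M) (satN : saturated C N) :
  bijective (Qhat_Ext C M N :
    {additive dirlim (ext_system C M N) ->
       Ext1 (Qhat C M : Sat C) (Qhat C N : Sat C)}) /\
  bijective (sat_Ext C M N :
    {additive Ext1 (Qhat C M : Sat C) (Qhat C N : Sat C) ->
       Ext1 (Qfun C M : serre_quotient C) (Qfun C N : serre_quotient C)}).
Proof.
split; last exact: sat_Ext_bij.
exact: inj_surj_bij (Qhat_Ext_inj satN) (Qhat_Ext_surj satM satN).
Qed.
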